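(* Let $\varepsilon>0$. Suppose that $\Sigma_{\mathrm{pk}}$ is bounded. Let $\rho>0$ and let $k\in\{1,\dots,n\}$ be such that $\Sigma_{\mathrm{pk}}\subset\Sigma^{(k)}$. Define $$\gamma_{\mathrm{pk}}=\inf\bigl\{\sigma_n\bigl(\begin{bmatrix}B & AB & \cdots & A^{n-1}B\end{bmatrix}\bigr)\ \big|\ (A,B)\in\Sigma_{\mathrm{pk}}\bigr\}.$$ Then the following statements hold: (a) There exist $T\in\mathbb{N}$ and $u_{[0,T-1]}\in\mathbb{R}^{mT}$ such that $$\sigma_{n+m}\bigl(M^{(k)}_{A,B}D_{A}^{(k)}\mathcal{H}_{k+1}(u_{[0,T-1]})\bigr)\ \ge\ \varepsilon\sqrt{T(k+1)}\,\|d_A^{(k)}\|_1\,\|M_{A}^{(k)}\|+\frac{\varepsilon}{\rho}\sqrt{T}\,\|d_A^{(k)}\|_1$$ holds for all $(A,B)\in\Sigma_{\mathrm{pk}}$ if and only if $\gamma_{\mathrm{pk}}>0$. (b) If $\gamma_{\mathrm{pk}}>0$, then $\Sigma_{\mathrm{pk}}$ enables universal experiment design for $\rho$-accuracy identification.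
   Context: Let $n,m\in\mathbb{N}$, $\varepsilon\ge 0$, and $\Sigma=\mathbb{R}^{n\times n}\times\mathbb{R}^{n\times m}$. $\|\cdot\|$ is the Euclidean norm for vectors and spectral norm for matrices, $\|\cdot\|_1$ the vector 1-norm. $\sigma_1(M)\ge\sigma_2(M)\ge\cdots$ are the singular values of $M\in\mathbb{R}^{p\times q}$, with $\sigma_i(M)=0$ for $i>\min\{p,q\}$. A signal $u(0),\dots,u(T-1)\in\mathbb{R}^m$ is identified with the stacked vector $u_{[0,T-1]}\in\mathbb{R}^{mT}$; similarly for $x_{[0,T]}$. For $T\in\mathbb{N}$ and $(A,B)\in\Sigma$, $\mathfrak{B}_T(A,B)$ is the set of all pairs $(u_{[0,T-1]},x_{[0,T]})$, with $u(t)\in\mathbb{R}^m$, $x(t)\in\mathbb{R}^n$, for which there exist $w(0),\dots,w(T-1)\in\mathbb{R}^n$ with $\|w(t)\|\le\varepsilon$ and $x(t+1)=Ax(t)+Bu(t)+w(t)$ for $t=0,\dots,T-1$. $\mathfrak{B}(A,B,u_{[0,T-1]})$ is the set of those elements of $\mathfrak{B}_T(A,B)$ whose input part equals the given $u_{[0,T-1]}$. For a dataset $\mathcal{D}$, $\Sigma_{\mathcal{D}}=\{(A,B)\in\Sigma\mid \mathcal{D}\in\mathfrak{B}_T(A,B)\}$. For a nonempty bounded set $\mathcal{X}\subset\mathbb{R}^{p\times q}$, its Chebyshev radius is $\operatorname{rad}\mathcal{X}=\inf_{C\in\mathcal{X}}\sup_{X\in\mathcal{X}}\|C-X\|$ (the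 infimum is over centers $C$ in the set $\mathcal{X}$ itself). For a bounded set of pairs $\Sigma_s\subseteq\Sigma$, $\operatorname{rad}\Sigma_s$ is the radius of $\{[A\ \ B]\mid (A,B)\in\Sigma_s\}$; the inequality $\operatorname{rad}\Sigma_s\le\rho$ includes that $\Sigma_s$ is bounded. $\Sigma_{\mathrm{pk}}\subseteq\Sigma$ is the prior knowledge set (it contains the unknown true system, hence is nonempty). A dataset $\mathcal{D}\in\mathfrak{B}_T(A,B)$ with $(A,B)\in\Sigma_{\mathrm{pk}}$ is $\Sigma_{\mathrm{pk}}$-informative for $\rho$-accuracy identification if $\operatorname{rad}(\Sigma_{\mathcal{D}}\cap\Sigma_{\mathrm{pk}})\le\rho$. An input $u_{[0,T-1]}\in\mathbb{R}^{mT}$ is $\Sigma_{\mathrm{pk}}$-universal for $\rho$-accuracy identification if every $\mathcal{D}\in\bigcup_{(A,B)\in\Sigma_{\mathrm{pk}}}\mathfrak{B}(A,B,u_{[0,T-1]})$ is $\Sigma_{\mathrm{pk}}$-informative for $\rho$-accuracy identification. $\Sigma_{\mathrm{pk}}$ enables universal experiment design for $\rho$-accuracy identification if there exists an input $u_{[0,T-1]}$ (for some $T\in\mathbb{N}$) that is $\Sigma_{\mathrm{pk}}$-universal for $\rho$-accuracy identification. For $1\le j\le T$, the Hankel matrix $\mathcal{H}_j(u_{[0,T-1]})$ of depth $j$ is the $mj\times(T-j+1)$ matrix whose columns are, for $i=0,\dots,T-j$, the stacked vectors of $u(i),\dots,u(i+j-1)$; writing $\mathcal{H}_{k+1}(u_{[0,T-1]})$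 thus presupposes $T\ge k+1$. $\Sigma^{(k)}$ is the set of $(A,B)\in\Sigma$ such that the minimal polynomial of $A$ has degree at most $k$. For $(A,B)\in\Sigma^{(k)}$, let $d_0,\dots,d_k\in\mathbb{R}$ satisfy $\sum_{i=0}^k d_iA^i=0$ and $d_k=1$ (for $k=n$, the coefficients of the characteristic polynomial of $A$), and define $d_A^{(k)}=[d_0\ \cdots\ d_k]^\top$, $$M_{A,B}^{(k)}=\begin{bmatrix}0 & B & AB & \cdots & A^{k-1}B\\ I_m & 0 & 0 & \cdots & 0\end{bmatrix},\quad M_{A}^{(k)}=\begin{bmatrix}0 & I_n & A & \cdots & A^{k-1}\\ I_n & 0 & 0 & \cdots & 0\end{bmatrix},\quad D_A^{(k)}=\begin{bmatrix} d_0 & \cdots & d_{k-1} & d_k\\ d_1 & \cdots & d_k & 0\\ \vdots & & \vdots & \vdots\\ d_k & \cdots & 0 & 0\end{bmatrix}\otimes I_m$$ (the $(i,j)$ entry, $i,j=0,\dots,k$, of the left Kronecker factor is $d_{i+j}$ if $i+j\le k$ and $0$ otherwise). *)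

(* Defs.v *)
From HB Require Import structures.
From mathcomp Require Import all_boot all_order all_algebra.
From mathcomp Require Import all_classical all_reals.

Set Implicit Arguments.
Unset Strict Implicit.
Unset Printing Implicit Defensive.

Import Order.TTheory GRing.Theory Num.Theory.
Local Open Scope classical_set_scope.
Local Open Scope ring_scope.

Section Norms.
Context {R : realType}.

Definition euclidean_norm n (v : 'cV[R]_n) : R :=
  Num.sqrt (\sum_i v i 0 ^+ 2).

Definition norm1 n (v : 'cV[R]_n) : R := \sum_i `|v i 0|.

(* The norm `|M| of the library is the entrywise maximum; the spectral norm is
   the operator norm induced by the Euclidean norms. *)
Definition spectral_norm p q (M : 'M[R]_(p, q)) : R :=
  sup [set euclidean_norm (M *m v) | v in [set v | euclidean_norm v <= 1]].

(* s lists, in nonincreasing order, the nonnegative square roots of the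
   eigenvalues of M^T *m M counted with multiplicity; hence size s = q, and
   the entries of s beyond the first minn p q vanish. *)
Definition is_singular_values p q (M : 'M[R]_(p, q)) (s : seq R) : Prop :=
  [/\ sorted >=%R s, all (fun x => 0 <= x) s
    & char_poly (M^T *m M) = \prod_(x <- s) ('X - (x ^+ 2)%:P)].

Definition singular_values p q (M : 'M[R]_(p, q)) : seq R :=
  xget [::] [set s | is_singular_values M s].

(* The index i is counted from 1, and the value is 0 for i > minn p q. *)
Definition singular_value p q (i : nat) (M : 'M[R]_(p, q)) : R :=
  (singular_values M)`_i.-1.

End Norms.

Section Systems.
Context {R : realType} {n m : nat}.

Definition system : Type := ('M[R]_n * 'M[R]_(n, m))%type.

Definition bounded_systems (S : set system) : Prop :=
  exists r : R, forall X, S X -> spectral_norm (row_mx X.1 X.2) <= r.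

Definition chebyshev_radius (S : set system) : R :=
  inf [set sup [set spectral_norm (row_mx C.1 C.2 - row_mx X.1 X.2) | X in S]
      | C in S].

(* Since inf and sup of real sets are total functions, boundedness has to be
   part of the inequality. *)
Definition radius_le (S : set system) (rho : R) : Prop :=
  bounded_systems S /\ chebyshev_radius S <= rho.

Definition input (T : nat) : Type := 'I_T -> 'cV[R]_m.

Definition dataset (T : nat) : Type := (input T * ('I_T.+1 -> 'cV[R]_n))%type.

(* As an index in 'I_T.+1, time t : 'I_T is widen_ord _ t and time t + 1 is
   lift ord0 t. *)
Definition behavior (eps : R) (T : nat) (S : system) : set (dataset T) :=
  [set D | exists2 w : 'I_T -> 'cV[R]_n,
       forall t, euclidean_norm (w t) <= eps &
       forall t : 'I_T, D.2 (lift ord0 t) =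
         S.1 *m D.2 (widen_ord (leqnSn T) t) + S.2 *m D.1 t + w t].

Definition behavior_with_input (eps : R) (T : nat) (S : system) (u : input T) :
    set (dataset T) :=
  [set D | behavior eps S D /\ D.1 = u].

Definition consistent_systems (eps : R) (T : nat) (D : dataset T) :
    set system :=
  [set S | behavior eps S D].

Definition informative (eps : R) (Spk : set system) (rho : R) (T : nat)
    (D : dataset T) : Prop :=
  radius_le (consistent_systems eps D `&` Spk) rho.

Definition universal_input (eps : R) (Spk : set system) (rho : R) (T : nat)
    (u : input T) : Prop :=
  forall D, (\bigcup_(S in Spk) behavior_with_input eps S u) D ->
    informative eps Spk rho D.

Definition enables_universal_design (eps : R) (Spk : set system) (rho : R) :
    Prop :=
  exists T : nat, (0 < T)%N /\
    exists u : input T, universal_input eps Spk rho u.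

End Systems.

Arguments system R n m : clear implicits.
Arguments input R m T : clear implicits.
Arguments dataset R n m T : clear implicits.

Section Matrices.
Context {R : realType}.

(* The default value 0 is never used when j <= T, which has to be assumed
   wherever hankel occurs; then also (T - j).+1 = T - j + 1. *)
Definition hankel m T (j : nat) (u : input R m T) :
    'M[R]_(\sum_(l < j) m, (T - j).+1) :=
  \mxcol_(l < j) \matrix_(a < m, i < (T - j).+1)
    (oapp u 0 (insub (i + l)%N)) a 0.

Definition controllability_mx n m (A : 'M[R]_n) (B : 'M[R]_(n, m)) :
    'M[R]_(n, \sum_(j < n) m) :=
  \mxrow_(j < n) (A ^+ j *m B).

(* The block matrix with rows [0 B AB ... A^(k-1)B] and [I 0 0 ... 0]; for
   B = 1%:M this is [0 I A ... A^(k-1)] over [I 0 0 ... 0]. *)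
Definition M_mx n m (k : nat) (A : 'M[R]_n) (B : 'M[R]_(n, m)) :
    'M[R]_(n + m, \sum_(j < k.+1) m) :=
  col_mx (\mxrow_(j < k.+1) (if j == 0%N :> nat then 0 else A ^+ j.-1 *m B))
         (\mxrow_(j < k.+1) (if j == 0%N :> nat then 1%:M else 0)).

(* The Kronecker product with the identity of size m, written blockwise. *)
Definition D_mx (m k : nat) (d : 'cV[R]_k.+1) :
    'M[R]_(\sum_(i < k.+1) m, \sum_(j < k.+1) m) :=
  \mxblock_(i < k.+1, j < k.+1)
    ((if (i + j <= k)%N then d (inord (i + j)%N) 0 else 0)%:M : 'M[R]_m).

(* mxminpoly is only defined for matrices of positive size, whence n.+1. *)
Definition minpoly_degree_le n m (k : nat) : set (system R n.+1 m) :=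
  [set S | (degree_mxminpoly S.1 <= k)%N].

(* d selects a vector [d_0 ... d_k] for each A whose minimal polynomial has
   degree at most k. For k < n.+1 this vector need not be unique; for
   k = n.+1 it is the one of the characteristic polynomial. *)
Definition annihilating_coefs n (k : nat) (d : 'M[R]_n.+1 -> 'cV[R]_k.+1) :
    Prop :=
  forall A : 'M[R]_n.+1, (degree_mxminpoly A <= k)%N ->
    [/\ \sum_(i < k.+1) d A i 0 *: A ^+ i = 0, d A ord_max 0 = 1
      & k = n.+1 -> forall i : 'I_k.+1, d A i 0 = (char_poly A)`_i].

Definition gamma_pk n m (Spk : set (system R n m)) : R :=
  inf [set singular_value n (controllability_mx S.1 S.2) | S in Spk].

End Matrices.

(* Main.v *)
Require Import Defs.
From mathcomp Require Import all_boot all_order all_algebra.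
From mathcomp Require Import all_classical all_reals.
From mathcomp Require Import complex lra ring zify.

(** Write [v *m M *m D *m H] for a row vector [v = row_mx xi eta].  The product
    [v *m M] lists the Markov parameters [eta], [xi *m B], [xi *m A *m B], ...,
    and [D] convolves them, backwards in time, with the filter [d]
    ([mul_M_mx], [mul_D_mx]).  As [d] annihilates [A], this convolution continues
    with zeros ([conv_markov]).

    Existence of the input.  A convolution whose filter is normalised can be
    inverted with a constant that depends on its length only
    ([deconvolution]); so, when the controllability matrices are uniformly
    nondegenerate, [v *m M *m D] is at least a constant times
    [norm1 d * frob v], uniformly in the systems and in the filters
    ([filtered_markov_lb]).  Separate impulses in the input channels give a
    Hankel matrix whose columns include a multiple of each unit vector
    ([impulse_input]).  Their amplitude is arbitrary while the horizon is fixed,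
    so that the singular value can be made to exceed any prescribed multiple of
    [norm1 d], and the right-hand side of the inequality is such a multiple
    because the systems are bounded ([exists_exciting_input]).

    Necessity of [0 < gamma_pk Spk].  For [eta = 0] the first block of [v *m M]
    vanishes and the others are blocks of [xi] times the controllability
    matrix, while [D *m H] has norm at most a constant times [norm1 d].  The
    inequality hence bounds the singular values of the controllability matrices
    away from 0 ([exciting_controllable]).

    Universality.  Filtering the data with [d] removes the unknown state at the
    start of each window; the filtered data are [M *m D *m H] plus filtered
    noise.  The difference of two systems consistent with the data maps the
    filtered data to filtered noise, and the inequality bounds it by twice the
    accuracy ([consistent_close]).  Chebyshev centers are taken in the set
    itself, so this diameter bound also bounds the radius, and part (b) follows
    from the existence of the input for the accuracy [rho / 2]
    ([exciting_universal]).

    All of this uses one fact on singular values: the [p]-th singular value of a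
    matrix with [p] rows is the largest factor by which it stretches all row
    vectors ([singular_value_lb], [singular_value_ge]).  It follows from
    diagonalising [M *m M^T] over the complex numbers and from the coincidence
    of the nonzero eigenvalues of [M *m M^T] and [M^T *m M] ([count_gram]). *)

Set Implicit Arguments.
Unset Strict Implicit.
Unset Printing Implicit Defensive.
Import Order.TTheory GRing.Theory Num.Theory.
Local Open Scope classical_set_scope.
Local Open Scope ring_scope.

(** * The Frobenius norm *)

Section Frobenius.
Context {R : realType}.

Definition frob2 p q (M : 'M[R]_(p, q)) : R := \sum_i \sum_j M i j ^+ 2.

(** On columns this is [euclidean_norm]; having one norm for rows, columns and
    matrices spares the conversions between them. *)
Definition frob p q (M : 'M[R]_(p, q)) : R := Num.sqrt (frob2 M).

Lemma frob2_ge0 p q (M : 'M[R]_(p, q)) : 0 <= frob2 M.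
Proof. by do 2!apply: sumr_ge0 => ? _; exact: sqr_ge0. Qed.

Lemma frob_ge0 p q (M : 'M[R]_(p, q)) : 0 <= frob M.
Proof. exact: sqrtr_ge0. Qed.

Lemma sqr_frob p q (M : 'M[R]_(p, q)) : frob M ^+ 2 = frob2 M.
Proof. by rewrite sqr_sqrtr // frob2_ge0. Qed.

Lemma ler_frob p q r s (M : 'M[R]_(p, q)) (N : 'M[R]_(r, s)) :
  (frob M <= frob N) = (frob2 M <= frob2 N).
Proof. by rewrite -!sqr_frob ler_sqr // nnegrE frob_ge0. Qed.

Lemma frob_le p q (M : 'M[R]_(p, q)) (c : R) :
  0 <= c -> frob2 M <= c ^+ 2 -> frob M <= c.
Proof. by move=> c0; rewrite -sqr_frob ler_sqr // nnegrE frob_ge0. Qed.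

Lemma frob2_entry p q (M : 'M[R]_(p, q)) i j : M i j ^+ 2 <= frob2 M.
Proof.
rewrite /frob2 (bigD1 i) //= (bigD1 j) //= -addrA lerDl addr_ge0 //.
  by apply: sumr_ge0 => ? _; exact: sqr_ge0.
by do 2!apply: sumr_ge0 => ? _; exact: sqr_ge0.
Qed.

Lemma frob_entry p q (M : 'M[R]_(p, q)) i j : `|M i j| <= frob M.
Proof.
have M0 := frob_ge0 M.
by rewrite -(ger0_norm M0) -ler_sqr ?nnegrE // !real_normK ?num_real //
           sqr_frob frob2_entry.
Qed.

Lemma frob2_eq0 p q (M : 'M[R]_(p, q)) : frob2 M = 0 -> M = 0.
Proof.
move=> M0; apply/matrixP => i j; rewrite mxE; apply/eqP; rewrite -sqrf_eq0.
by rewrite eq_le sqr_ge0 -M0 frob2_entry.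
Qed.

Lemma frob2_gt0 p q (M : 'M[R]_(p, q)) : M != 0 -> 0 < frob2 M.
Proof.
by move=> M0; rewrite lt_def frob2_ge0 andbT; apply: contra_neq M0 => /frob2_eq0.
Qed.

Lemma frob_gt0 p q (M : 'M[R]_(p, q)) : M != 0 -> 0 < frob M.
Proof. by rewrite sqrtr_gt0; exact: frob2_gt0. Qed.

Lemma frob2_0 p q : frob2 (0 : 'M[R]_(p, q)) = 0.
Proof. by rewrite /frob2; do 2!rewrite big1 // => ? _; rewrite !mxE expr0n. Qed.

Lemma frob0 p q : frob (0 : 'M[R]_(p, q)) = 0.
Proof. by rewrite /frob frob2_0 sqrtr0. Qed.

Lemma frob2_tr p q (M : 'M[R]_(p, q)) : frob2 M^T = frob2 M.
Proof.
by rewrite /frob2 exchange_big; do 2!apply: eq_bigr => ? _; rewrite mxE.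
Qed.

Lemma frob_tr p q (M : 'M[R]_(p, q)) : frob M^T = frob M.
Proof. by rewrite /frob frob2_tr. Qed.

Lemma frob2Z p q (a : R) (M : 'M[R]_(p, q)) : frob2 (a *: M) = a ^+ 2 * frob2 M.
Proof.
rewrite /frob2 mulr_sumr; apply: eq_bigr => i _; rewrite mulr_sumr.
by apply: eq_bigr => j _; rewrite mxE exprMn.
Qed.

Lemma frobZ p q (a : R) (M : 'M[R]_(p, q)) : frob (a *: M) = `|a| * frob M.
Proof. by rewrite /frob frob2Z sqrtrM ?sqr_ge0 // sqrtr_sqr. Qed.

Lemma frob2_row n (v : 'rV[R]_n) : frob2 v = \sum_j v 0 j ^+ 2.
Proof. by rewrite /frob2 big_ord1. Qed.

Lemma mul_tr_frob2 n (v : 'rV[R]_n) : (v *m v^T) 0 0 = frob2 v.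
Proof. by rewrite frob2_row mxE; apply: eq_bigr => j _; rewrite mxE. Qed.

Lemma euclidean_frob n (v : 'cV[R]_n) : euclidean_norm v = frob v.
Proof.
by rewrite /frob -frob2_tr frob2_row; congr Num.sqrt;
   apply: eq_bigr => j _; rewrite mxE.
Qed.

Lemma frob2_row_mx p q r (M : 'M[R]_(p, q)) (N : 'M[R]_(p, r)) :
  frob2 (row_mx M N) = frob2 M + frob2 N.
Proof.
rewrite /frob2 -big_split; apply: eq_bigr => i _.
rewrite big_split_ord /=.
by congr (_ + _); apply: eq_bigr => j _; rewrite (row_mxEl, row_mxEr).
Qed.

Lemma frob2_mxrow p (I : nat) (q_ : 'I_I -> nat) (M : forall i, 'M[R]_(p, q_ i)) :
  frob2 (\mxrow_i M i) = \sum_i frob2 (M i).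
Proof.
rewrite /frob2 [RHS]exchange_big; apply: eq_bigr => i _ /=.
rewrite [RHS]sig_big_dep /= (reindex _ tagnat.sig_bij_on)/=.
by apply: eq_bigr => l _; rewrite mxE.
Qed.

Lemma frob2_col p q (M : 'M[R]_(p, q)) : frob2 M = \sum_j frob2 (col j M).
Proof.
rewrite /frob2 exchange_big; apply: eq_bigr => j _ /=.
by apply: eq_bigr => i _; rewrite big_ord1 mxE.
Qed.

Lemma frob2_mxcol p (I : nat) (q_ : 'I_I -> nat) (M : forall i, 'M[R]_(q_ i, p)) :
  frob2 (\mxcol_i M i) = \sum_i frob2 (M i).
Proof.
by rewrite -frob2_tr tr_mxcol frob2_mxrow; apply: eq_bigr => i _; rewrite frob2_tr.
Qed.

(** The difference of the two sides is half the sum of the squares of the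
    minors [a i * b j - a j * b i]. *)
Lemma cauchy_schwarz_sum (I : finType) (a b : I -> R) :
  (\sum_i a i * b i) ^+ 2 <= (\sum_i a i ^+ 2) * (\sum_i b i ^+ 2).
Proof.
rewrite -(ler_pM2l (_ : 0 < 2)) // -subr_ge0.
suff -> : 2 * ((\sum_i a i ^+ 2) * (\sum_i b i ^+ 2))
          - 2 * (\sum_i a i * b i) ^+ 2 =
          \sum_i \sum_j (a i * b j - a j * b i) ^+ 2.
  by do 2!apply: sumr_ge0 => ? _; exact: sqr_ge0.
have E1 : (\sum_i a i ^+ 2) * (\sum_i b i ^+ 2) =
          \sum_i \sum_j a i ^+ 2 * b j ^+ 2.
  by rewrite mulr_suml; apply: eq_bigr => i _; rewrite mulr_sumr.
have E2 : (\sum_i a i * b i) ^+ 2 = \sum_i \sum_j (a i * b i) * (a j * b j).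
  by rewrite expr2 mulr_suml; apply: eq_bigr => i _; rewrite mulr_sumr.
rewrite mulr2n mulrDl mul1r {2}E1 [X in _ + X - _]exchange_big /= {1}E1 E2.
rewrite -big_split /= mulr_sumr -sumrB; apply: eq_bigr => i _.
rewrite -big_split /= mulr_sumr -sumrB; apply: eq_bigr => j _; ring.
Qed.

Lemma frob2M p q r (M : 'M[R]_(p, q)) (N : 'M[R]_(q, r)) :
  frob2 (M *m N) <= frob2 M * frob2 N.
Proof.
rewrite -(frob2_tr N) /frob2 mulr_suml; apply: ler_sum => i _.
rewrite mulr_sumr; apply: ler_sum => j _; rewrite mxE.
under [X in _ <= _ * X]eq_bigr do rewrite mxE.
exact: cauchy_schwarz_sum.
Qed.

Lemma frobM p q r (M : 'M[R]_(p, q)) (N : 'M[R]_(q, r)) :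
  frob (M *m N) <= frob M * frob N.
Proof.
rewrite frob_le ?mulr_ge0 ?frob_ge0 // exprMn !sqr_frob; exact: frob2M.
Qed.

Lemma frobD p q (M N : 'M[R]_(p, q)) : frob (M + N) <= frob M + frob N.
Proof.
rewrite frob_le ?addr_ge0 ?frob_ge0 // sqrrD !sqr_frob.
have -> : frob2 (M + N) =
    frob2 M + (\sum_i \sum_j M i j * N i j) *+ 2 + frob2 N.
  rewrite /frob2 -sumrMnl -!big_split /=; apply: eq_bigr => i _.
  by rewrite -sumrMnl -!big_split /=; apply: eq_bigr => j _; rewrite mxE sqrrD.
rewrite lerD2r lerD2l lerMn2r /= !pair_big /=.
apply: le_trans (ler_norm _) _.
rewrite -ler_sqr ?nnegrE ?mulr_ge0 ?frob_ge0 // exprMn !sqr_frob.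
rewrite real_normK ?num_real // /frob2 !pair_big /=.
exact: (cauchy_schwarz_sum (fun x => M x.1 x.2) (fun x => N x.1 x.2)).
Qed.

Lemma frobN p q (M : 'M[R]_(p, q)) : frob (- M) = frob M.
Proof. by rewrite -scaleN1r frobZ normrN1 mul1r. Qed.

Lemma frobB p q (M N : 'M[R]_(p, q)) : frob (M - N) <= frob M + frob N.
Proof. by rewrite -(frobN N); exact: frobD. Qed.

Lemma frob_sum (I : Type) (r : seq I) (P : pred I) p q (M : I -> 'M[R]_(p, q)) :
  frob (\sum_(i <- r | P i) M i) <= \sum_(i <- r | P i) frob (M i).
Proof.
elim/big_ind2: _ => [|x M1 y M2 h1 h2|//]; first by rewrite frob0.
by apply: le_trans (frobD _ _) _; rewrite lerD.
Qed.

Lemma frob2_le_entries p q (M : 'M[R]_(p, q)) (c : R) :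
  (forall i j, `|M i j| <= c) -> frob2 M <= (p * q)%:R * c ^+ 2.
Proof.
move=> Mc; apply: (@le_trans _ _ (\sum_(i < p) \sum_(j < q) c ^+ 2)).
  apply: ler_sum => i _; apply: ler_sum => j _.
  rewrite -real_normK ?num_real // lerXn2r ?nnegrE ?Mc //.
  exact: le_trans (normr_ge0 _) (Mc i j).
by rewrite !sumr_const !card_ord -mulrnA mulnC mulr_natl.
Qed.

End Frobenius.

(** * The spectral norm *)

Section SpectralNorm.
Context {R : realType}.

Local Notation opset M :=
  [set euclidean_norm (M *m v) | v in [set v | euclidean_norm v <= 1]].

Lemma opset_has_sup p q (M : 'M[R]_(p, q)) : has_sup (opset M).
Proof.
split; first by exists 0; exists 0 => /=; rewrite ?mulmx0 ?euclidean_frob frob0.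
exists (frob M) => _ [v /= v1 <-]; rewrite euclidean_frob in v1.
rewrite euclidean_frob (le_trans (frobM _ _)) // -[leRHS]mulr1.
by rewrite ler_wpM2l ?frob_ge0.
Qed.

Lemma spectral_norm_ub p q (M : 'M[R]_(p, q)) (v : 'cV[R]_q) :
  frob (M *m v) <= spectral_norm M * frob v.
Proof.
have [->|v0] := eqVneq v 0; first by rewrite mulmx0 !frob0 mulr0.
have fv := frob_gt0 v0.
rewrite -ler_pdivrMr // mulrC -[_^-1]ger0_norm ?invr_ge0 ?frob_ge0 //.
rewrite -frobZ scalemxAr -euclidean_frob.
apply: sup_ubound; first exact: (opset_has_sup M).2.
exists ((frob v)^-1 *: v) => //=.
by rewrite euclidean_frob frobZ ger0_norm ?invr_ge0 ?frob_ge0 // mulVf ?gt_eqF.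
Qed.

Lemma spectral_norm_le p q (M : 'M[R]_(p, q)) (c : R) : 0 <= c ->
  (forall v : 'cV[R]_q, frob (M *m v) <= c * frob v) -> spectral_norm M <= c.
Proof.
move=> c0 Mc; apply: ge_sup; first exact: (opset_has_sup M).1.
move=> _ [v /= v1 <-]; rewrite euclidean_frob in v1.
by rewrite euclidean_frob (le_trans (Mc v)) // -[leRHS]mulr1 ler_wpM2l.
Qed.

Lemma spectral_norm_ge0 p q (M : 'M[R]_(p, q)) : 0 <= spectral_norm M.
Proof.
apply: sup_ubound; first exact: (opset_has_sup M).2.
by exists 0 => /=; rewrite ?mulmx0 euclidean_frob frob0.
Qed.

(** A matrix and its transpose have the same operator norm; this is the half
    of that fact obtained by applying [M] to [(v *m M)^T]. *)
Lemma spectral_norm_ub_row p q (M : 'M[R]_(p, q)) (v : 'rV[R]_p) :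
  frob (v *m M) <= spectral_norm M * frob v.
Proof.
have [E|vM0] := eqVneq (v *m M) 0.
  by rewrite E frob0 mulr_ge0 ?spectral_norm_ge0 ?frob_ge0.
rewrite -(ler_pM2r (frob_gt0 vM0)) -expr2 sqr_frob -mul_tr_frob2 -mulmxA.
apply: le_trans (ler_norm _) _; apply: le_trans (frob_entry _ _ _) _.
apply: le_trans (frobM _ _) _; rewrite [leRHS]mulrAC mulrC.
by rewrite ler_wpM2r ?frob_ge0 // (le_trans (spectral_norm_ub _ _)) // frob_tr.
Qed.

Lemma spectral_norm_le_row p q (M : 'M[R]_(p, q)) (c : R) : 0 <= c ->
  (forall v : 'rV[R]_p, frob (v *m M) <= c * frob v) -> spectral_norm M <= c.
Proof.
move=> c0 Mc; apply: spectral_norm_le => // v.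
have [E|Mv0] := eqVneq (M *m v) 0.
  by rewrite E frob0 mulr_ge0 ?frob_ge0.
rewrite -(ler_pM2r (frob_gt0 Mv0)) -expr2 sqr_frob -frob2_tr -mul_tr_frob2.
rewrite trmxK mulmxA; apply: le_trans (ler_norm _) _.
apply: le_trans (frob_entry _ _ _) _; apply: le_trans (frobM _ _) _.
by rewrite [leRHS]mulrAC ler_wpM2r ?frob_ge0 // (le_trans (Mc _)) // frob_tr.
Qed.

End SpectralNorm.

(** * Singular values *)

(** Multiplying the block matrix [[X, M], [N, 1]] by a block triangular matrix
    on either side clears one of its off-diagonal blocks. *)
Lemma char_poly_mulmxC (K : comNzRingType) p q (M : 'M[K]_(p, q))
    (N : 'M[K]_(q, p)) :
  'X^q * char_poly (M *m N) = 'X^p * char_poly (N *m M).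
Proof.
pose Mp := map_mx polyC M; pose Np := map_mx polyC N.
pose W : 'M[{poly K}]_(p + q) := block_mx 'X%:M Mp Np 1%:M.
have E1 : W *m block_mx 1%:M 0 (- Np) 1%:M =
          block_mx (char_poly_mx (M *m N)) Mp 0 1%:M.
  rewrite mulmx_block !mulmx1 !mulmx0 !mulmxN !mul1mx !add0r subrr.
  by rewrite /char_poly_mx map_mxM.
have E2 : block_mx 1%:M 0 (- Np) 'X%:M *m W =
          block_mx 'X%:M Mp 0 (char_poly_mx (N *m M)).
  rewrite mulmx_block !mul1mx !mul0mx !addr0 !mulNmx mulmx1.
  rewrite mul_scalar_mx mul_mx_scalar addNr.
  by rewrite /char_poly_mx map_mxM addrC.
have D1 : \det W = char_poly (M *m N).
  by have /(congr1 determinant) := E1;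
     rewrite det_mulmx det_lblock det_ublock !det1 !mulr1.
have /(congr1 determinant) := E2.
by rewrite det_mulmx det_lblock det_ublock det1 mul1r !det_scalar D1.
Qed.

Lemma char_poly_similar (K : fieldType) p (P D : 'M[K]_p) : P \in unitmx ->
  char_poly (invmx P *m D *m P) = char_poly D.
Proof.
move=> Punit; have Xp0 : 'X^p != 0 :> {poly K} by rewrite monic_neq0 ?monicXn.
by apply: (mulfI Xp0); rewrite -mulmxA char_poly_mulmxC -mulmxA mulmxV ?mulmx1.
Qed.

Section HermitianSpectrum.
Local Open Scope sesquilinear_scope.

(** The numbers [w i] are the coordinates of [v] in a unitary eigenbasis
    of [S]. *)
Lemma hermitian_spectrum (C : numClosedFieldType) p (S : 'M[C]_p) :
  S \is hermsymmx ->
  exists d : 'I_p -> C,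
    [/\ forall i, d i \is Num.real,
        char_poly S = \prod_i ('X - (d i)%:P)
      & forall v : 'rV[C]_p, exists w : 'I_p -> C,
          (v *m v^t*) 0 0 = \sum_i `|w i| ^+ 2 /\
          (v *m S *m v^t*) 0 0 = \sum_i d i * `|w i| ^+ 2].
Proof.
move=> Sherm; have /orthomx_spectralP := hermitian_normalmx Sherm.
have Dreal := hermitian_spectral_diag_real Sherm.
have := spectral_unitarymx S; have := spectral_unit S.
move: (spectralmx S) (spectral_diag S) Dreal => P D Dreal Punit Puni SE.
exists (D 0); split=> [i||v]; first by apply/mxOverP.
  rewrite SE char_poly_similar // char_poly_trig; last exact: diag_mx_is_trig.
  by apply: eq_bigr => i _; rewrite mxE eqxx mulr1n.
have [w wP] : {w | w = v *m P^t*} by exists (v *m P^t*).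
have wE : w^t* = P *m v^t* by rewrite wP trmx_mul map_mxM trmxCK.
exists (w 0); split.
  have -> : v *m v^t* = w *m w^t*.
    by rewrite wE wP mulmxA -(mulmxA v) -(invmx_unitary Puni) mulVmx // mulmx1.
  by rewrite mxE; apply: eq_bigr => i _; rewrite !mxE normCK.
have -> : v *m S *m v^t* = w *m diag_mx D *m w^t*.
  by rewrite wE wP SE -(invmx_unitary Puni) !mulmxA.
by rewrite mxE; apply: eq_bigr => i _; rewrite mul_mx_diag !mxE normCK mulrAC mulrC.
Qed.

(** The theory of Hermitian matrices applies over [R[i]]; the eigenvalues it
    provides are real, and so are the entries of [v], which brings both the
    characteristic polynomial and the quadratic form back to [R]. *)
Lemma symmetric_spectrum (R : realType) p (S : 'M[R]_p) : S^T = S ->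
  exists2 l : 'I_p -> R, char_poly S = \prod_i ('X - (l i)%:P)
    & forall (c : R), (forall i, c <= l i) ->
        forall v : 'rV[R]_p, c * frob2 v <= (v *m S *m v^T) 0 0.
Proof.
move=> Ssym; pose toC := real_complex R.
have SCherm : map_mx toC S \is hermsymmx.
  apply: realsym_hermsym.
    by apply/is_hermitianmxP; rewrite scale1r; apply/matrixP => i j;
       rewrite !mxE -[in LHS]Ssym mxE.
  by apply/mxOverP => i j; rewrite mxE; apply/complex_realP; exists (S i j).
have [d [dreal dchar dform]] := hermitian_spectrum SCherm.
pose l i : R := complex.Re (d i).
have dE i : d i = toC (l i) by rewrite /l /toC RRe_real.
exists l.
  apply: (@map_poly_inj _ _ (real_complex R)).
  rewrite map_char_poly; apply: etrans dchar _; rewrite rmorph_prod.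
  by apply: eq_bigr => i _; rewrite dE rmorphB /= map_polyX map_polyC.
move=> c lc v; have [w [wnorm wform]] := dform (map_mx toC v).
have vCE : (map_mx toC v)^t* = map_mx toC v^T.
  by apply/matrixP => i j; rewrite !mxE; exact: conjc_real.
rewrite vCE in wnorm wform.
have normE : toC (frob2 v) = \sum_i `|w i| ^+ 2.
  by rewrite -wnorm -mul_tr_frob2 -map_mxM [RHS]mxE.
have formE : toC ((v *m S *m v^T) 0 0) = \sum_i d i * `|w i| ^+ 2.
  by rewrite -wform -!map_mxM [RHS]mxE.
rewrite -lecR rmorphM /= -/(toC _) -/(toC _) -/(toC _) normE formE mulr_sumr.
apply: ler_sum => i _; rewrite dE ler_wpM2r ?exprn_ge0 //.
by rewrite lecR.
Qed.

End HermitianSpectrum.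

Section SingularValues.
Context {R : realType}.

Lemma gram_form p q (M : 'M[R]_(p, q)) (v : 'rV[R]_p) :
  (v *m (M *m M^T) *m v^T) 0 0 = frob2 (v *m M).
Proof. by rewrite -mul_tr_frob2 trmx_mul !mulmxA. Qed.

Lemma gram_spectrum p q (M : 'M[R]_(p, q)) :
  exists l : 'I_p -> R,
    [/\ char_poly (M *m M^T) = \prod_i ('X - (l i)%:P),
        forall i, exists2 v : 'rV[R]_p, v != 0
          & frob2 (v *m M) = l i * frob2 v
      & forall c, (forall i, c <= l i) ->
          forall v : 'rV[R]_p, c * frob2 v <= frob2 (v *m M)].
Proof.
have [|l lchar lform] := @symmetric_spectrum _ _ (M *m M^T).
  by rewrite trmx_mul trmxK.
exists l; split=> [//|i|c lc v]; last by rewrite -gram_form; exact: lform.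
have /eigenvalueP[v vE v0] : eigenvalue (M *m M^T) (l i).
  rewrite eigenvalue_root_char lchar rootE horner_prod (bigD1 i) //=.
  by rewrite !hornerE subrr mul0r.
by exists v => //; rewrite -gram_form vE -scalemxAl mxE mul_tr_frob2.
Qed.

Lemma gram_spectrum_ge0 p q (M : 'M[R]_(p, q)) (v : 'rV[R]_p) (a : R) :
  v != 0 -> frob2 (v *m M) = a * frob2 v -> 0 <= a.
Proof.
by move=> v0 E; rewrite -(pmulr_lge0 _ (frob2_gt0 v0)) -E frob2_ge0.
Qed.

Lemma singular_valuesP p q (M : 'M[R]_(p, q)) :
  is_singular_values M (singular_values M).
Proof.
rewrite /singular_values; apply: xgetPex.
have [l [lchar leig _]] := gram_spectrum M^T; rewrite trmxK in lchar.
have l0 i : 0 <= l i by have [v v0] := leig i; exact: gram_spectrum_ge0.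
exists (sort >=%R [seq Num.sqrt (l i) | i <- enum 'I_q]); split.
- by apply: sort_sorted => x y /=; rewrite orbC le_total.
- by rewrite all_sort; apply/allP => _ /mapP[i _ ->]; exact: sqrtr_ge0.
rewrite (perm_big _ (permEl (perm_sort _ _))) /= big_map big_enum /= lchar.
by apply: eq_bigr => i _; rewrite sqr_sqrtr.
Qed.

Lemma count_sorted_ge (s : seq R) (a : R) (j : nat) :
  sorted >=%R s -> 0 < s`_j -> a <= s`_j -> (j < count (>= a) s)%N.
Proof.
move=> ssort sj0 asj.
have js : (j < size s)%N.
  by rewrite ltnNge; apply: contraTN sj0 => /(nth_default 0) ->; rewrite ltxx.
rewrite -(cat_take_drop j.+1 s) count_cat.
suff /eqP -> : count (>= a) (take j.+1 s) == j.+1 by rewrite ltnS leq_addr.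
rewrite -[X in _ == X](size_takel js) -all_count; apply/(all_nthP 0) => i.
rewrite (size_takel js) => ij; rewrite nth_take // (le_trans asj) //.
have ge_trans : transitive (>=%R : rel R).
  by move=> x y z /= h1 h2; exact: le_trans h2 h1.
have := @sorted_leq_nth _ >=%R ge_trans (@lexx _ _) 0 s ssort i j.
by apply; rewrite ?inE // (leq_trans ij).
Qed.

Lemma count_sorted_lt (s : seq R) (a : R) (j : nat) :
  sorted >=%R s -> s`_j < a -> (count (>= a) s <= j)%N.
Proof.
move=> ssort sja.
rewrite -(cat_take_drop j s) count_cat.
suff /eqP -> : count (>= a) (drop j s) == 0%N.
  by rewrite addn0 (leq_trans (count_size _ _)) // size_take_min geq_minl.
rewrite -leqn0 leqNgt -has_count; apply/(has_nthP 0) => -[r].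
rewrite size_drop ltn_subRL nth_drop => rs; apply/negP; rewrite -ltNge.
apply: le_lt_trans sja.
have ge_trans : transitive (>=%R : rel R).
  by move=> x y z /= h1 h2; exact: le_trans h2 h1.
have := @sorted_leq_nth _ >=%R ge_trans (@lexx _ _) 0 s ssort j (j + r).
by apply; rewrite ?inE ?leq_addr // (leq_ltn_trans _ rs) ?leq_addr.
Qed.

(** The nonzero eigenvalues of [M *m M^T] and of [M^T *m M] agree with their
    multiplicities, so above any positive threshold the two spectra have the
    same number of elements. *)
Lemma count_gram p q (M : 'M[R]_(p, q)) (l : 'I_p -> R) (s : seq R) (c : R) :
    0 < c -> is_singular_values M s ->
    char_poly (M *m M^T) = \prod_i ('X - (l i)%:P) ->
  #|[pred i | c ^+ 2 <= l i]| = count (>= c) s.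
Proof.
move=> c0 [_ s0 schar] lchar.
have XE n : 'X^n = \prod_(x <- nseq n (0 : R)) ('X - x%:P).
  by rewrite big_nseq subr0 iter_mulr_1.
have := char_poly_mulmxC M M^T; rewrite schar lchar !XE.
rewrite -big_enum /= -(big_map l xpredT (fun x => 'X - x%:P)).
rewrite -(big_map (fun x => x ^+ 2) xpredT (fun x => 'X - x%:P)) -!big_cat /=.
move=> /prod_XsubC_eq/permP/(_ (>= c ^+ 2)); rewrite !count_cat !count_nseq.
rewrite lt_geF ?exprn_gt0 // !mul0n !add0n !count_map => E.
rewrite cardE size_filter.
apply: etrans _ (etrans E _); first exact: eq_count.
apply: eq_in_count => x /(allP s0) x0 /=.
by rewrite ler_sqr // nnegrE ltW.
Qed.

(** If [l i] were below the square of the singular value, fewer than [p + 1]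
    eigenvalues of [M *m M^T] would reach that square, but at least [p + 1] of
    those of [M^T *m M] do.  When [M] has fewer columns than rows, the singular
    value is the default 0. *)
Lemma singular_value_lb p q (M : 'M[R]_(p.+1, q)) (v : 'rV[R]_p.+1) :
  singular_value p.+1 M * frob v <= frob (v *m M).
Proof.
have sP := singular_valuesP M; have [ssort s0 _] := sP.
have [l [lchar leig lform]] := gram_spectrum M.
rewrite /singular_value /=; set a := (singular_values M)`_p.
have [a0|a0] := leP a 0.
  by rewrite (le_trans _ (frob_ge0 _)) // mulr_le0_ge0 ?frob_ge0.
rewrite -ler_sqr ?nnegrE ?mulr_ge0 ?frob_ge0 ?(ltW a0) // exprMn !sqr_frob.
apply: lform => i; rewrite leNgt; apply/negP => li_lt.
have := count_sorted_ge ssort a0 (lexx a).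
rewrite -(count_gram a0 sP lchar) ltnNge => /negP; apply.
rewrite -ltnS -[X in (_ < X)%N]card_ord proper_card //.
by apply/properP; split; [exact/subset_predT|exists i; rewrite ?inE // leNgt li_lt].
Qed.

Lemma singular_value_ge p q (M : 'M[R]_(p.+1, q)) (c : R) :
  (forall v : 'rV[R]_p.+1, c * frob v <= frob (v *m M)) ->
  c <= singular_value p.+1 M.
Proof.
move=> Mc; have sP := singular_valuesP M; have [ssort s0 _] := sP.
have [l [lchar leig lform]] := gram_spectrum M.
rewrite /singular_value /=; set a := (singular_values M)`_p.
have a0 : 0 <= a.
  have [ps|ps] := ltnP p (size (singular_values M)); first exact: (all_nthP _ s0).
  by rewrite /a nth_default.
have [c0|c0] := leP c 0; first exact: le_trans c0 a0.
rewrite leNgt; apply/negP => /(count_sorted_lt ssort).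
rewrite -(count_gram c0 sP lchar) leqNgt => /negP; apply.
rewrite (@eq_card _ _ 'I_p.+1) ?card_ord // => i; rewrite !inE; have [v v0 E] := leig i.
rewrite -(ler_pM2r (frob2_gt0 v0)) -E -!sqr_frob -exprMn.
by rewrite ler_sqr ?nnegrE ?mulr_ge0 ?frob_ge0 ?(ltW c0) ?Mc.
Qed.

End SingularValues.

(** * Deconvolution *)

Section Deconvolution.
Context {R : realType}.
Implicit Types d g : nat -> R.

Definition conv d g (i : nat) : R := \sum_(j < i.+1) d j * g (i - j)%N.

Lemma deconvolution_lead (theta : R) (N : nat) (eta : R) : 0 < theta -> 0 < eta ->
  exists2 delta, 0 < delta & forall d g,
    theta <= `|d 0%N| -> (forall j, `|d j| <= 1) ->
    (forall i, (i <= N)%N -> `|conv d g i| <= delta) ->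
    forall i, (i <= N)%N -> `|g i| <= eta.
Proof.
move=> theta0; elim: N eta => [|N IH] eta eta0.
  exists (theta * eta) => [|d g d0 d1 dg i]; first exact: mulr_gt0.
  rewrite leqn0 => /eqP ->; rewrite -(ler_pM2l theta0).
  apply: le_trans (dg 0%N (leqnn _)).
  by rewrite /conv big_ord1 normrM ler_wpM2r.
have N0 : 0 < N.+1%:R :> R by rewrite ltr0Sn.
pose eta' := Num.min eta (theta * eta / 2 / N.+1%:R).
have eta'0 : 0 < eta' by rewrite lt_min eta0 !divr_gt0 ?mulr_gt0.
have [delta delta0 Hd] := IH _ eta'0.
exists (Num.min delta (theta * eta / 2)) => [|d g d0 d1 dg].
  by rewrite lt_min delta0 divr_gt0 ?mulr_gt0.
have Hg i : (i <= N)%N -> `|g i| <= eta'.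
  apply: (Hd d g) => // j jN.
  by apply: le_trans (dg j (leqW jN)) _; rewrite ge_min lexx.
move=> i; rewrite leq_eqVlt => /predU1P[->|]; last first.
  by rewrite ltnS => /Hg/le_trans -> //; rewrite ge_min lexx.
have E : d 0%N * g N.+1 = conv d g N.+1 - \sum_(j < N.+1) d j.+1 * g (N - j)%N.
  by rewrite /conv big_ord_recl subn0 addrK.
have S : `|\sum_(j < N.+1) d j.+1 * g (N - j)%N| <= theta * eta / 2.
  apply: le_trans (ler_norm_sum _ _ _) _.
  apply: (@le_trans _ _ (\sum_(j < N.+1) eta')).
    apply: ler_sum => j _; rewrite normrM -[leRHS]mul1r.
    by rewrite ler_pM // Hg // leq_subr.
  rewrite sumr_const card_ord -(mulr_natr eta') -ler_pdivlMr //.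
  by rewrite ge_min lexx orbT.
rewrite -(ler_pM2l theta0); apply: (@le_trans _ _ `|d 0%N * g N.+1|).
  by rewrite normrM ler_wpM2r.
rewrite E (le_trans (ler_normB _ _)) // [leRHS]splitr lerD //.
by apply: le_trans (dg _ (leqnn _)) _; rewrite ge_min lexx orbT.
Qed.

(** If the leading coefficient [d 0] is not small, the sequence is recovered
    term by term; otherwise that coefficient perturbs the convolution only
    slightly, and dropping it leaves a shorter filter, tested on one term
    fewer.  The normalisation of [d] ensures that some coefficient stops this
    descent, so [delta] does not depend on the filter. *)
Lemma deconvolution (k N : nat) (eta : R) : 0 < eta ->
  exists2 delta, 0 < delta & forall d g,
    (forall j, `|d j| <= 1) -> (forall j, (k < j)%N -> d j = 0) ->
    (exists j, 1 <= `|d j|) ->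
    (forall i, (i <= k + N)%N -> `|g i| <= 1) ->
    (forall i, (i <= k + N)%N -> `|conv d g i| <= delta) ->
    forall i, (i <= N)%N -> `|g i| <= eta.
Proof.
move=> eta0; elim: k => [|k [delta' delta'0 IH]].
  have [delta delta0 H] := deconvolution_lead N ltr01 eta0.
  exists delta => // d g d1 dk [j dj] _ dg; apply: (H d g) => //.
  by case: j dj => // j; rewrite dk // normr0 ler10.
pose theta := Num.min (delta' / 2) (1 / 2).
have theta0 : 0 < theta by rewrite lt_min !divr_gt0.
have [delta2 delta20 H] := deconvolution_lead N theta0 eta0.
exists (Num.min (delta' / 2) delta2) => [|d g d1 dk [j dj] g1 dg].
  by rewrite lt_min delta20 divr_gt0.
have [d0|d0] := leP theta `|d 0%N|.
  apply: (H d g) => // i iN.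
  have /dg/le_trans -> // : (i <= k.+1 + N)%N by rewrite (leq_trans iN) ?leq_addl.
  by rewrite ge_min lexx orbT.
apply: (IH (fun j => d j.+1) g) => // [i ik||i ik|i ik].
- exact: dk.
- case: j dj => [|j dj]; last by exists j.
  have : theta <= 1 / 2 by rewrite ge_min lexx orbT.
  by move: d0 => /[swap] h /lt_le_trans/(_ h); lra.
- by apply: g1; rewrite (leq_trans ik).
have -> : conv (fun j => d j.+1) g i = conv d g i.+1 - d 0%N * g i.+1.
  by rewrite /conv [in RHS]big_ord_recl subn0 addrC addKr.
rewrite (le_trans (ler_normB _ _)) // [leRHS]splitr lerD //.
  by have /dg/le_trans -> // : (i.+1 <= k.+1 + N)%N by []; rewrite ge_min lexx.
rewrite normrM -[leRHS]mulr1 ler_pM // ?g1 ?addSn //.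
rewrite (le_trans (ltW d0)) //.
by rewrite ge_min lexx.
Qed.

End Deconvolution.

(** * Markov parameters and the annihilating filter *)

Section Markov.
Context {R : realType}.

(** The outputs of the system for the output row [xi] and the feedthrough
    [eta], in response to a unit impulse. *)
Definition markov n m (A : 'M[R]_n) (B : 'M[R]_(n, m)) (xi : 'rV[R]_n)
    (eta : 'rV[R]_m) (i : nat) : 'rV[R]_m :=
  if i is i'.+1 then xi *m (A ^+ i' *m B) else eta.

(** Continued by zero, so that sums over shifted indices need no bounds. *)
Definition coef k (d : 'cV[R]_k.+1) (l : nat) : R :=
  if (l <= k)%N then d (inord l) 0 else 0.

Lemma convZ (a b : R) (f g : nat -> R) i :
  conv (fun l => a * f l) (fun l => b * g l) i = a * b * conv f g i.
Proof. by rewrite /conv mulr_sumr; apply: eq_bigr => l _; ring. Qed.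

Lemma coef_ord k (d : 'cV[R]_k.+1) (i : 'I_k.+1) : coef d i = d i 0.
Proof. by rewrite /coef -ltnS ltn_ord inord_val. Qed.

Lemma coef_gt k (d : 'cV[R]_k.+1) (l : nat) : (k < l)%N -> coef d l = 0.
Proof. by rewrite /coef ltnNge => /negbTE ->. Qed.

Lemma mul_M_mx n m k (A : 'M[R]_n) (B : 'M[R]_(n, m)) (xi : 'rV[R]_n)
    (eta : 'rV[R]_m) :
  row_mx xi eta *m M_mx k A B = \mxrow_(j < k.+1) markov A B xi eta j.
Proof.
rewrite /M_mx mul_row_col !mul_mxrow -mxrowD; apply: eq_mxrow => j.
by case: (val j) => [|j'] /=; rewrite ?mulmx0 ?mulmx1 ?add0r ?addr0.
Qed.

Lemma mul_D_mx m k p (d : 'cV[R]_k.+1) (g : nat -> 'M[R]_(p, m)) :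
  \mxrow_(j < k.+1) g j *m D_mx m d =
  \mxrow_(j < k.+1) \sum_(i < k.+1) coef d (i + j) *: g i.
Proof.
rewrite /D_mx mul_mxrow_mxblock; apply: eq_mxrow => j.
by apply: eq_bigr => i _; rewrite mul_mx_scalar.
Qed.

Lemma mul_controllability_mx n m (A : 'M[R]_n) (B : 'M[R]_(n, m))
    (xi : 'rV[R]_n) :
  frob2 (xi *m controllability_mx A B) =
  \sum_(i < n) frob2 (markov A B xi 0 i.+1).
Proof. by rewrite /controllability_mx mul_mxrow frob2_mxrow. Qed.

Lemma spectral_norm_row_mxl n m p (A : 'M[R]_(n, m)) (B : 'M[R]_(n, p)) :
  spectral_norm A <= spectral_norm (row_mx A B).
Proof.
apply: spectral_norm_le (spectral_norm_ge0 _) _ => v.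
have := spectral_norm_ub (row_mx A B) (col_mx v 0).
by rewrite mul_row_col mulmx0 addr0 -(frob_tr (col_mx _ _)) tr_col_mx trmx0
  /frob frob2_row_mx frob2_0 addr0 frob2_tr.
Qed.

Lemma spectral_norm_row_mxr n m p (A : 'M[R]_(n, m)) (B : 'M[R]_(n, p)) :
  spectral_norm B <= spectral_norm (row_mx A B).
Proof.
apply: spectral_norm_le (spectral_norm_ge0 _) _ => v.
have := spectral_norm_ub (row_mx A B) (col_mx 0 v).
by rewrite mul_row_col mulmx0 add0r -(frob_tr (col_mx _ _)) tr_col_mx trmx0
  /frob frob2_row_mx frob2_0 add0r frob2_tr.
Qed.

Lemma frob_mul_expmx n (A : 'M[R]_n) (xi : 'rV[R]_n) (r : R) i : 0 <= r ->
  spectral_norm A <= r -> frob (xi *m A ^+ i) <= r ^+ i * frob xi.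
Proof.
move=> r0 Ar; elim: i => [|i IH]; first by rewrite !expr0 mulmx1 mul1r.
rewrite exprSr mulmxA (le_trans (spectral_norm_ub_row _ _)) // exprS -mulrA.
by rewrite ler_pM ?spectral_norm_ge0 ?frob_ge0.
Qed.

Lemma markov_growth n m (A : 'M[R]_n) (B : 'M[R]_(n, m)) (xi : 'rV[R]_n)
    (eta : 'rV[R]_m) (r : R) (i K : nat) :
  1 <= r -> spectral_norm A <= r -> spectral_norm B <= r -> (i <= K)%N ->
  frob (markov A B xi eta i) <= r ^+ K * frob (row_mx xi eta).
Proof.
move=> r1 Ar Br iK; have r0 : 0 <= r by exact: le_trans r1.
have xiv : frob xi <= frob (row_mx xi eta).
  by rewrite ler_frob frob2_row_mx lerDl frob2_ge0.
have etav : frob eta <= frob (row_mx xi eta).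
  by rewrite ler_frob frob2_row_mx lerDr frob2_ge0.
have rK j : (j <= K)%N -> r ^+ j <= r ^+ K by move=> jK; rewrite ler_weXn2l.
case: i iK => [|i] iK /=.
  by rewrite (le_trans etav) // -[leLHS]mul1r ler_wpM2r ?frob_ge0 // -(expr0 r) rK.
rewrite mulmxA (le_trans (spectral_norm_ub_row _ _)) //.
apply: (@le_trans _ _ (r * (r ^+ i * frob xi))).
  by rewrite ler_pM ?spectral_norm_ge0 ?frob_ge0 // frob_mul_expmx.
by rewrite mulrA -exprS ler_pM ?exprn_ge0 ?frob_ge0 ?rK.
Qed.

(** The filter [d] reversed in time turns the Markov parameters into the
    blocks of [v *m M *m D], listed backwards, followed by zeros because [d]
    annihilates [A]. *)
Lemma conv_markov n m k (A : 'M[R]_n) (B : 'M[R]_(n, m)) (d : 'cV[R]_k.+1)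
    (xi : 'rV[R]_n) (eta : 'rV[R]_m) (a : 'I_m) (i : nat) :
  \sum_(i < k.+1) d i 0 *: A ^+ i = 0 ->
  conv (fun l => if (l <= k)%N then coef d (k - l) else 0)
       (fun l => markov A B xi eta l 0 a) i =
  if (i <= k)%N
  then (\sum_(l < k.+1) coef d (l + (k - i)) *: markov A B xi eta l) 0 a else 0.
Proof.
move=> dA; rewrite /conv; case: leqP => ik.
  rewrite summxE (reindex_inj rev_ord_inj) /=.
  rewrite (big_ord_widen k.+1 (fun l =>
     (if (i.+1 - l.+1 <= k)%N then coef d (k - (i.+1 - l.+1)) else 0) *
     markov A B xi eta (i - (i.+1 - l.+1)) 0 a)) //.
  rewrite big_mkcond /=; apply: eq_bigr => l _; rewrite mxE; case: ifP => li.
    rewrite subSS ifT; last by lia.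
    by congr (coef d _ * markov A B xi eta _ 0 a); lia.
  by rewrite coef_gt ?mul0r //; lia.
rewrite (eq_bigr (fun l : 'I_i.+1 => if (l < k.+1)%N then
    coef d (k - l) * markov A B xi eta (i - l) 0 a else 0)); last first.
  by move=> l _; rewrite ltnS; case: ifP; rewrite ?mul0r.
rewrite -big_mkcond /= -(big_ord_widen i.+1 (fun l =>
     coef d (k - l) * markov A B xi eta (i - l) 0 a)) 1?ltnW //.
rewrite (reindex_inj rev_ord_inj) /=.
transitivity
    ((xi *m ((\sum_(i < k.+1) d i 0 *: A ^+ i) *m A ^+ (i - k.+1) *m B)) 0 a);
  last by rewrite dA !mul0mx mulmx0 mxE.
rewrite !mulmx_suml mulmx_sumr summxE; apply: eq_bigr => l _.
have lk := ltn_ord l.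
have -> : (i - (k.+1 - l.+1) = (l + (i - k.+1)).+1)%N by lia.
rewrite /= exprD -!scalemxAl -scalemxAr [RHS]mxE.
by congr (_ * _); rewrite -coef_ord; congr coef; lia.
Qed.

(** The constant [c] serves all filters [d] at once, although these may be
    unbounded and need not come from minimal polynomials: if [v *m M *m D] were
    small compared with [norm1 d * frob v], deconvolution would make the first
    [n + 1] Markov parameters small compared with [frob v], against
    controllability. *)
Lemma filtered_markov_lb n m k (r gamma : R) : 1 <= r -> 0 < gamma ->
  exists2 c, 0 < c & forall (A : 'M[R]_n) (B : 'M[R]_(n, m)) (d : 'cV[R]_k.+1),
    spectral_norm A <= r -> spectral_norm B <= r ->
    (forall xi : 'rV[R]_n, gamma * frob xi <= frob (xi *m controllability_mx A B)) ->
    \sum_(i < k.+1) d i 0 *: A ^+ i = 0 ->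
    forall v : 'rV[R]_(n + m),
      c * norm1 d * frob v <= frob (v *m (M_mx k A B *m D_mx m d)).
Proof.
move=> r1 gamma0; have r0 : 0 < r by exact: lt_le_trans r1.
pose C := r ^+ (k + n); have C0 : 0 < C by exact: exprn_gt0.
pose g1 := Num.min 1 gamma; have g10 : 0 < g1 by rewrite lt_min ltr01.
(* [C * frob v] bounds the Markov parameters that occur; [(n + 1) * m] of their
   entries are to stay below [e * C * frob v], which has to keep the sum of
   their squares below [g1 ^+ 2 * frob2 v]. *)
pose e := g1 / (2 * n.+1%:R * m.+1%:R * C).
have den0 : 0 < 2 * n.+1%:R * m.+1%:R * C by rewrite !mulr_gt0.
have e0 : 0 < e by rewrite divr_gt0.
have [delta delta0 H] := deconvolution k n e0.
exists (delta * C / k.+1%:R) => [|A B d Ar Br AB dA v].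
  by rewrite !mulr_gt0 ?invr_gt0.
rewrite -(hsubmxK v); move: (lsubmx v) (rsubmx v) => xi eta {v}.
set v := row_mx xi eta.
rewrite mulmxA mul_M_mx mul_D_mx leNgt; apply/negP => small.
have [v0 d0] : 0 < frob v /\ 0 < norm1 d.
  have d0 : 0 <= norm1 d by apply: sumr_ge0.
  have := frob_ge0 (\mxrow_(j < k.+1)
    \sum_(i < k.+1) coef d (i + j) *: markov A B xi eta i).
  move=> /le_lt_trans/(_ small) pos.
  split; rewrite lt_def ?frob_ge0 ?d0 andbT; apply: contraTneq pos => ->;
    by rewrite ?(mulr0, mul0r) ltxx.
have [j0 d_max] : exists j0 : 'I_k.+1, forall j, `|d j 0| <= `|d j0 0|.
  by case: (@Order.TotalTheory.arg_maxP _ _ _ ord0 xpredT (fun j => `|d j 0|))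
    => // j0 _ h; exists j0 => j; exact: h.
set D := `|d j0 0| in d_max.
have dD : norm1 d <= k.+1%:R * D.
  apply: (@le_trans _ _ (\sum_(i < k.+1) D)); first exact: ler_sum.
  by rewrite sumr_const card_ord mulr_natl.
have D0 : 0 < D.
  by rewrite -(pmulr_rgt0 _ (_ : 0 < k.+1%:R)) // (lt_le_trans d0).
have y_small j a : (j <= k)%N ->
    `|(\sum_(i < k.+1) coef d (i + j) *: markov A B xi eta i) 0 a|
    <= delta * (D * (C * frob v)).
  move=> jk; pose y (j : nat) := \sum_(i < k.+1) coef d (i + j) *: markov A B xi eta i.
  apply: le_trans (frob_entry (y j) _ _) _.
  apply: (@le_trans _ _ (frob (\mxrow_(j < k.+1) y j))).
    rewrite ler_frob frob2_mxrow (bigD1 (inord j)) //= inordK // lerDl.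
    by apply: sumr_ge0 => ? _; exact: frob2_ge0.
  apply: le_trans (ltW small) _.
  have -> : delta * C / k.+1%:R * norm1 d * frob v =
            delta * (C * frob v) * (norm1 d / k.+1%:R) by ring.
  have -> : delta * (D * (C * frob v)) = delta * (C * frob v) * D by ring.
  rewrite ler_wpM2l ?mulr_ge0 ?frob_ge0 ?(ltW C0) ?(ltW delta0) //.
  by rewrite ler_pdivrMr // mulrC.
set V := C * frob v in y_small.
have V0 : 0 < V by rewrite mulr_gt0.
pose f l := if (l <= k)%N then coef d (k - l) else 0.
have g_small i a : (i <= n)%N -> `|markov A B xi eta i 0 a| <= e * V.
  move=> iN; have := H (fun l => D^-1 * f l)
    (fun l => V^-1 * markov A B xi eta l 0 a) _ _ _ _ _ i iN.
  rewrite normrM gtr0_norm ?invr_gt0 // ler_pdivrMl // mulrC; apply.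
  - move=> j; rewrite normrM gtr0_norm ?invr_gt0 // ler_pdivrMl // mulr1 /f.
    case: leqP => _; last by rewrite normr0 ltW.
    by rewrite /coef leq_subr d_max.
  - by move=> j kj; rewrite /f leqNgt kj mulr0.
  - exists (k - j0)%N; rewrite /f leq_subr subKn -1?ltnS // coef_ord.
    by rewrite normrM gtr0_norm ?invr_gt0 // mulVf // gt_eqF.
  - move=> j jkn; rewrite normrM gtr0_norm ?invr_gt0 // ler_pdivrMl // mulr1.
    exact: le_trans (frob_entry _ _ _) (markov_growth _ _ r1 Ar Br jkn).
  - move=> j _; rewrite convZ conv_markov // normrM -invfM.
    rewrite gtr0_norm ?invr_gt0 ?mulr_gt0 // ler_pdivrMl ?mulr_gt0 // mulrC.
    case: leqP => jk; last by rewrite normr0 !mulr_ge0 // ltW.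
    by apply: y_small; rewrite leq_subr.
have frob_small i : (i <= n)%N -> frob2 (markov A B xi eta i) <= m%:R * (e * V) ^+ 2.
  move=> iN; rewrite -[X in X%:R]mul1n; apply: frob2_le_entries => i' a.
  by rewrite ord1 g_small.
have large : g1 ^+ 2 * frob2 v <= \sum_(i < n.+1) frob2 (markov A B xi eta i).
  rewrite big_ord_recl /= frob2_row_mx mulrDr addrC lerD //.
    rewrite -[leRHS]mul1r ler_wpM2r ?frob2_ge0 // expr_le1 ?(ltW g10) //.
    by rewrite ge_min lexx.
  have : (gamma * frob xi) ^+ 2 <= frob (xi *m controllability_mx A B) ^+ 2.
    by rewrite ler_sqr ?nnegrE ?mulr_ge0 ?frob_ge0 ?(ltW gamma0) ?AB.
  rewrite exprMn !sqr_frob mul_controllability_mx; apply: le_trans.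
  rewrite ler_wpM2r ?frob2_ge0 // lerXn2r ?nnegrE ?(ltW g10) ?(ltW gamma0) //.
  by rewrite ge_min lexx orbT.
have : g1 ^+ 2 * frob2 v <= n.+1%:R * (m%:R * (e * V) ^+ 2).
  apply: le_trans large _.
  apply: (@le_trans _ _ (\sum_(i < n.+1) m%:R * (e * V) ^+ 2)).
    by apply: ler_sum => i _; rewrite frob_small // -ltnS.
  by rewrite sumr_const card_ord [leRHS]mulr_natl.
have -> : e * V = g1 * frob v / (2 * n.+1%:R * m.+1%:R).
  by rewrite /e /V; field; rewrite !nat1r !pnatr_eq0 /= gt_eqF.
rewrite -sqr_frob -exprMn; apply/negP; rewrite -ltNge.
set X := g1 * frob v; have X0 : 0 < X by rewrite mulr_gt0.
set N := n.+1%:R; set M := m.+1%:R.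
have N1 : 1 <= N by rewrite ler1n.
have M1 : 1 <= M by rewrite ler1n.
have N0 : 0 < N by rewrite ltr0n.
have M0 : 0 < M by rewrite ltr0n.
have mM : m%:R <= M by rewrite ler_nat.
clearbody N M.
have NM1 : 1 <= N * M by rewrite mulr_ege1.
have -> : N * (m%:R * (X / (2 * N * M)) ^+ 2) =
          X ^+ 2 * (N * m%:R / (2 * N * M) ^+ 2).
  by field; rewrite (gt_eqF N0) (gt_eqF M0).
rewrite -[ltRHS]mulr1 ltr_pM2l ?exprn_gt0 // ltr_pdivrMr ?exprn_gt0 //; last first.
  by rewrite !mulr_gt0.
rewrite mul1r; apply: (@le_lt_trans _ _ (N * M)).
  by rewrite ler_wpM2l // ltW.
by rewrite -mulrA; nra.
Qed.
End Markov.

(** * Hankel matrices and exciting inputs *)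

Lemma sum_shift (V : zmodType) (F : nat -> V) (k j : nat) :
  (forall l, (l < j)%N -> F l = 0) -> (forall l, (k < l)%N -> F l = 0) ->
  \sum_(s < k.+1) F (s + j)%N = \sum_(l < k.+1) F l.
Proof.
move=> Fj Fk; rewrite -(big_mkord xpredT (fun s => F (s + j)%N)) -(big_mkord xpredT F).
have -> : \sum_(0 <= s < k.+1) F (s + j)%N = \sum_(j <= l < k.+1 + j) F l.
  by have := big_addn 0 (k.+1 + j) j xpredT F; rewrite add0n addnK => ->.
have E : \sum_(0 <= l < k.+1 + j) F l = \sum_(j <= l < k.+1 + j) F l.
  rewrite (big_cat_nat (leq0n j) (leq_addl _ _)) /= big_nat_cond big1 ?add0r //.
  by move=> l /andP[/andP[_ lj] _]; exact: Fj.
rewrite -E (big_cat_nat (leq0n k.+1) (leq_addr _ _)) /=.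
rewrite [X in _ + X]big_nat_cond [X in _ + X]big1 ?addr0 //.
by move=> l /andP[/andP[kl _] _]; exact: Fk.
Qed.

Section Hankel.
Context {R : realType}.

(** The extension by zero is the one built into [hankel]. *)
Definition seq_of_input m T (u : input R m T) (t : nat) : 'cV[R]_m :=
  oapp u 0 (insub t).

Lemma seq_of_inputE m T (u : input R m T) (t : 'I_T) : seq_of_input u t = u t.
Proof. by rewrite /seq_of_input valK. Qed.

Lemma norm1_ge0 n (d : 'cV[R]_n) : 0 <= norm1 d.
Proof. exact: sumr_ge0. Qed.

Lemma sum_coef_le k (d : 'cV[R]_k.+1) (j : nat) :
  \sum_(s < k.+1) `|coef d (s + j)| <= norm1 d.
Proof.
pose F l := if (j <= l)%N then `|coef d l| else 0.
have -> : \sum_(s < k.+1) `|coef d (s + j)| = \sum_(s < k.+1) F (s + j)%N.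
  by apply: eq_bigr => s _; rewrite /F leq_addl.
rewrite sum_shift => [|l lj|l kl]; rewrite /F.
- by apply: ler_sum => l _; case: ifP => _; rewrite ?coef_ord.
- by rewrite leqNgt lj.
- by rewrite coef_gt // normr0 if_same.
Qed.

Lemma frob_filter_le n p k (d : 'cV[R]_k.+1) (j : nat) (c : R)
    (g : nat -> 'M[R]_(n, p)) :
  0 <= c -> (forall i, (i <= k)%N -> frob (g i) <= c) ->
  frob (\sum_(i < k.+1) coef d (i + j) *: g i) <= norm1 d * c.
Proof.
move=> c0 gc; apply: le_trans (frob_sum _ _ _) _.
apply: (@le_trans _ _ (\sum_(i < k.+1) `|coef d (i + j)| * c)).
  by apply: ler_sum => i _; rewrite frobZ ler_wpM2l // gc // -ltnS.
by rewrite -mulr_suml ler_wpM2r // sum_coef_le.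
Qed.

Lemma mul_hankelE m k T (u : input R m T) (y : nat -> 'rV[R]_m)
    (i : 'I_(T - k.+1).+1) :
  (\mxrow_(j < k.+1) y j *m hankel k.+1 u) 0 i =
  \sum_(j < k.+1) (y j *m seq_of_input u (i + j)) 0 0.
Proof.
rewrite /hankel mul_mxrow_mxcol summxE; apply: eq_bigr => j _.
by rewrite !mxE; apply: eq_bigr => a _; rewrite mxE.
Qed.

Lemma impulse_time (k a b j l : nat) : (j <= k)%N -> (l <= k)%N ->
  (k.+1 * a + (k - j) + l == k.+1 * b + k)%N = (a == b) && (j == l).
Proof.
move=> jk lk; apply/eqP/andP => [E|[/eqP <- /eqP <-]]; last by lia.
have ab : a = b.
  have [ab|ba|//] := ltngtP a b.
    by have : (k.+1 * a.+1 <= k.+1 * b)%N; [rewrite leq_mul2l ab orbT|lia].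
  by have : (k.+1 * b.+1 <= k.+1 * a)%N; [rewrite leq_mul2l ba orbT|lia].
by split; apply/eqP; lia.
Qed.

(** The input has one impulse in each channel, [k + 1] steps apart: each window
    of length [k + 1] sees at most one of them, and every pair of a channel and
    a position in the window occurs, so that the columns of the Hankel matrix
    include a multiple of every unit vector. *)
Lemma impulse_input m k : exists2 T : nat, (k < T)%N &
  forall beta : R, 0 <= beta -> exists u : input R m T,
    forall y : 'rV[R]_(\sum_(j < k.+1) m),
      beta * frob y <= frob (y *m hankel k.+1 u).
Proof.
exists (k.+1 * m.+1)%N => [|beta beta0].
  by rewrite -[X in (X <= _)%N]muln1 leq_mul.
(* The factor makes up for bounding the norm of [y] by its entries. *)
pose alpha := beta * (k.+1 * m.+1)%:R.
pose u : input R m (k.+1 * m.+1) :=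
  fun t => \col_a (alpha * (t == k.+1 * a + k :> nat)%:R).
exists u => y; rewrite -[y]submxrowK.
set h := frob (_ *m _).
have alpha0 : 0 <= alpha by rewrite mulr_ge0.
have entry (j : 'I_k.+1) (a : 'I_m) : alpha * `|submxrow y j 0 a| <= h.
  have ia : (k.+1 * a + (k - j) < (k.+1 * m.+1 - k.+1).+1)%N.
    by have := ltn_ord a; have := ltn_ord j; nia.
  apply: le_trans _ (frob_entry _ 0 (Ordinal ia)).
  pose ys (j : nat) := submxrow y (inord j).
  have -> : \mxrow_j submxrow y j = \mxrow_(j < k.+1) ys j.
    by apply: eq_mxrow => l; rewrite /ys inord_val.
  have term (l : 'I_k.+1) (b : 'I_m) :
      ys l 0 b * seq_of_input u (Ordinal ia + l)%N b 0 =
      if (l == j) && (b == a) then alpha * submxrow y j 0 a else 0.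
    have tT : (k.+1 * a + (k - j) + l < k.+1 * m.+1)%N.
      by have := ltn_ord a; have := ltn_ord j; have := ltn_ord l; nia.
    rewrite -[X in seq_of_input u X]/(val (Ordinal tT)) seq_of_inputE [u _ b 0]mxE /=.
    rewrite (impulse_time _ _ (leq_ord j) (leq_ord l)) !val_eqE.
    rewrite [l == j]eq_sym [b == a]eq_sym andbC.
    have [<-|_] := eqVneq j l; last by rewrite !mulr0.
    have [<-|_] := eqVneq a b; last by rewrite !mulr0.
    by rewrite /ys inord_val mulr1 mulrC.
  rewrite mul_hankelE (bigD1 j) //= big1 ?addr0 => [|l lj].
    rewrite [(ys j *m _) 0 0]mxE (bigD1 a) //= big1 ?addr0 => [|b ba].
      by rewrite term !eqxx normrM ger0_norm.
    by rewrite term (negbTE ba) andbF.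
  by rewrite [(ys l *m _) 0 0]mxE big1 // => b _; rewrite term (negbTE lj).
have [->|b0] := eqVneq beta 0; first by rewrite mul0r frob_ge0.
have {}beta0 : 0 < beta by rewrite lt_def b0.
have K0 : 0 < (k.+1 * m.+1)%:R :> R by rewrite ltr0n muln_gt0.
have {}alpha0 : 0 < alpha by rewrite mulr_gt0.
rewrite mulrC -ler_pdivlMr //; apply: frob_le; first by rewrite divr_ge0 ?frob_ge0 ?ltW.
have -> : h / beta = (k.+1 * m.+1)%:R * (h / alpha).
  by rewrite /alpha; move: (_%:R) K0 => K K0; field; rewrite b0 gt_eqF.
rewrite frob2_mxrow exprMn.
apply: (@le_trans _ _ (\sum_(j < k.+1) (1 * m)%:R * (h / alpha) ^+ 2)).
  apply: ler_sum => j _; apply: frob2_le_entries => i a.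
  by rewrite ord1 ler_pdivlMr // mulrC entry.
rewrite sumr_const card_ord -[leLHS]mulr_natl mulrA ler_wpM2r ?sqr_ge0 //.
by rewrite -natrM -natrX ler_nat mul1n; nia.
Qed.
End Hankel.

(** * Consistent systems are close to each other *)

Section Data.
Context {R : realType}.

Lemma addmxE p q (M N : 'M[R]_(p, q)) i j : (M + N) i j = M i j + N i j.
Proof. by rewrite mxE. Qed.

Lemma expmxS n (A : 'M[R]_n) l : A ^+ l.+1 = A *m A ^+ l.
Proof. exact: exprS. Qed.

Lemma variation_of_constants n (A : 'M[R]_n) (x v : nat -> 'cV[R]_n) (l : nat) :
  (forall j, (j < l)%N -> x j.+1 = A *m x j + v j) ->
  x l = A ^+ l *m x 0%N + \sum_(j < l) A ^+ (l - j.+1) *m v j.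
Proof.
elim: l => [|l IH] rec; first by rewrite big_ord0 addr0 expr0 mul1mx.
rewrite rec // IH => [|j jl]; last by apply: rec; rewrite ltnW.
rewrite mulmxDr mulmxA -expmxS -addrA big_ord_recr /= subnn expr0 mul1mx.
congr (_ + (_ + _)); rewrite mulmx_sumr; apply: eq_bigr => j _.
by rewrite mulmxA -expmxS -subSn // ltn_ord.
Qed.

(** The filter [d] cancels the influence of the state at the start of the
    window; what is left of the filtered state is driven by the input and the
    noise inside the window only. *)
Lemma filtered_state n k (A : 'M[R]_n) (d : 'cV[R]_k.+1) (x v : nat -> 'cV[R]_n)
    (xi : 'rV[R]_n) :
  \sum_(i < k.+1) d i 0 *: A ^+ i = 0 ->
  (forall j, (j < k)%N -> x j.+1 = A *m x j + v j) ->
  xi *m (\sum_(l < k.+1) coef d l *: x l) =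
  \sum_(j < k.+1) (\sum_(s < k.+1) coef d (s + j) *: markov A 1%:M xi 0 s) *m v j.
Proof.
move=> dA rec.
pose F (j l : nat) := if (j < l)%N then coef d l *: (xi *m A ^+ (l - j.+1)) else 0.
have E (j : 'I_k.+1) : \sum_(s < k.+1) coef d (s + j) *: markov A 1%:M xi 0 s =
             \sum_(l < k.+1) F j l.
  rewrite -(@sum_shift _ (F j) k j) => [|l lj|l kl]; rewrite /F.
  - apply: eq_bigr => -[[|s] sk] _ /=; first by rewrite add0n ltnn scaler0.
    by rewrite ltnS leq_addl mulmx1 addSn subSS addnK.
  - by rewrite ltnNge ltnW.
  - by rewrite coef_gt // scale0r if_same.
under [RHS]eq_bigr => j _ do rewrite E mulmx_suml.
rewrite exchange_big /=.
have -> : \sum_(l < k.+1) coef d l *: x l =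
    \sum_(l < k.+1) coef d l *: \sum_(j < l) A ^+ (l - j.+1) *m v j.
  have xE (l : 'I_k.+1) := @variation_of_constants _ A x v l
    (fun j jl => rec j (leq_trans jl (leq_ord l))).
  under eq_bigr => l _ do rewrite xE scalerDr scalemxAl.
  rewrite big_split /= -mulmx_suml.
  have -> : \sum_(l < k.+1) coef d l *: A ^+ l = 0.
    by apply: etrans dA; apply: eq_bigr => l _; rewrite coef_ord.
  by rewrite mul0mx add0r.
rewrite mulmx_sumr; apply: eq_bigr => l _.
rewrite -scalemxAr mulmx_sumr scaler_sumr.
rewrite (big_ord_widen k.+1
  (fun j => coef d l *: (xi *m (A ^+ (l - j.+1) *m v j)))) 1?ltnW //.
rewrite big_mkcond /=; apply: eq_bigr => j _; rewrite /F.
by case: ifP => _; rewrite ?mul0mx // -scalemxAl mulmxA.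
Qed.

Lemma behavior_seq n m (eps : R) T (S : system R n m) (D : dataset R n m T) :
  0 <= eps -> behavior eps S D ->
  exists2 w : input R n T, (forall t, frob (w t) <= eps) &
    forall t, (t < T)%N ->
      seq_of_input D.2 t.+1 = S.1 *m seq_of_input D.2 t +
        (S.2 *m seq_of_input D.1 t + seq_of_input w t).
Proof.
move=> eps0 [w weps rec]; exists w => [t|t tT]; first by rewrite -euclidean_frob.
pose x : input R n T.+1 := D.2.
have E1 : seq_of_input x t.+1 = x (lift ord0 (Ordinal tT)) :=
  seq_of_inputE x (lift ord0 (Ordinal tT)).
have E2 : seq_of_input x t = x (widen_ord (leqnSn T) (Ordinal tT)) :=
  seq_of_inputE x (widen_ord (leqnSn T) (Ordinal tT)).
have E3 : seq_of_input D.1 t = D.1 (Ordinal tT) :=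
  seq_of_inputE D.1 (Ordinal tT).
have E4 : seq_of_input w t = w (Ordinal tT) :=
  seq_of_inputE w (Ordinal tT).
by rewrite E1 E2 E3 E4 addrA -rec.
Qed.

Lemma frob_noise n k T (d : 'cV[R]_k.+1) (w : input R n T) (eps : R) :
  (k < T)%N -> 0 <= eps -> (forall t, frob (w t) <= eps) ->
  frob (D_mx n d *m hankel k.+1 w) <= eps * Num.sqrt (T * k.+1)%:R * norm1 d.
Proof.
move=> kT eps0 weps; have d0 := norm1_ge0 d.
apply: frob_le; first by rewrite !mulr_ge0 ?sqrtr_ge0.
have we t : frob (seq_of_input w t) <= eps.
  by rewrite /seq_of_input; case: insubP => [t' _ _|_] //=; rewrite frob0.
rewrite /D_mx /hankel mul_mxblock_mxrow frob2_mxcol.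
apply: (@le_trans _ _
  (\sum_(i < k.+1) \sum_(t < (T - k.+1).+1) (norm1 d * eps) ^+ 2)).
  apply: ler_sum => i _; rewrite frob2_col; apply: ler_sum => t _.
  rewrite -sqr_frob ler_sqr ?nnegrE ?frob_ge0 ?mulr_ge0 //.
  rewrite (_ : col t _ = \sum_(j < k.+1)
      coef d (j + (i : 'I_k.+1)) *: seq_of_input w ((t : 'I__) + j)).
    by apply: (@frob_filter_le _ _ _ _ d i eps (fun j => seq_of_input w (t + j))).
  apply/colP => a; rewrite !mxE !summxE; apply: eq_bigr => j _.
  by rewrite mul_scalar_mx !mxE addnC.
rewrite !sumr_const !card_ord -mulrnA -[leLHS]mulr_natl !exprMn sqr_sqrtr ?ler0n //.
have -> : eps ^+ 2 * (T * k.+1)%:R * norm1 d ^+ 2 =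
          (T * k.+1)%:R * (norm1 d ^+ 2 * eps ^+ 2) by ring.
by rewrite ler_wpM2r ?mulr_ge0 ?sqr_ge0 // ler_nat leq_mul // -subSn // subSS leq_subr.
Qed.

(** Applied to the filtered data [Z], the difference of the two systems leaves
    only filtered noise, bounded by [2 * eps] per unit of [norm1 d].  The first
    term of the condition pays for the contribution of the noise to the filtered
    state; by the second one, [Z] still stretches every row vector by enough to
    bound the difference itself. *)
Lemma consistent_close n m k T (eps rho : R) (u : input R m T) (x : 'I_T.+1 -> 'cV[R]_n)
    (S1 S2 : system R n m) (d : 'cV[R]_k.+1) :
  (k < T)%N -> 0 < eps -> 0 < rho -> d != 0 ->
  \sum_(i < k.+1) d i 0 *: S1.1 ^+ i = 0 ->
  (forall v : 'rV[R]_(n + m),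
    (eps * Num.sqrt (T * k.+1)%:R * norm1 d * spectral_norm (M_mx k S1.1 1%:M)
     + eps / rho * Num.sqrt T%:R * norm1 d) * frob v <=
    frob (v *m (M_mx k S1.1 S1.2 *m D_mx m d *m hankel k.+1 u))) ->
  behavior eps S1 (u, x) -> behavior eps S2 (u, x) ->
  spectral_norm (row_mx S1.1 S1.2 - row_mx S2.1 S2.2) <= 2 * rho.
Proof.
move=> kT eps0 rho0 d_neq0 dA excit.
move=> /(behavior_seq (ltW eps0)) [/= w1 w1e rec1].
move=> /(behavior_seq (ltW eps0)) [/= w2 w2e rec2].
pose xs := seq_of_input (x : input R n T.+1); pose us := seq_of_input u.
rewrite -/xs -/us in rec1 rec2.
have we w (we : forall t, frob (w t) <= eps) t :
    frob (seq_of_input (w : input R n T) t) <= eps.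
  by rewrite /seq_of_input; case: insubP => [t' _ _|_] //=; rewrite frob0 ltW.
pose z t := col_mx (xs t) (us t).
pose Z := \matrix_(a < n + m, i < (T - k.+1).+1)
  (\sum_(l < k.+1) coef d l *: z (i + l)%N) a 0.
set Delta := _ - _.
have window (i : 'I_(T - k.+1).+1) l : (l <= k)%N -> (i + l < T)%N.
  by have := ltn_ord i; lia.
have Deltaz t : (t < T)%N -> Delta *m z t = seq_of_input w2 t - seq_of_input w1 t.
  move=> tT; rewrite mulmxBl !mul_row_col.
  have := rec1 t tT; rewrite rec2 // !addrA => E.
  rewrite -[S1.1 *m xs t + _](addrK (seq_of_input w1 t)) -E.
  by rewrite [X in X - _ - _]addrC addrAC addrK.
have d0 : 0 < norm1 d.
  rewrite lt_def norm1_ge0 andbT; apply: contra_neq d_neq0 => /eqP.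
  rewrite psumr_eq0 // => /allP dE; apply/colP => i; rewrite mxE; apply/eqP.
  by rewrite -normr_eq0 (eqP (dE i (mem_index_enum _))).
have DeltaZ : frob (Delta *m Z) <= 2 * eps * norm1 d * Num.sqrt T%:R.
  have c0 : 0 <= norm1 d * (2 * eps) by rewrite !mulr_ge0 ?ltW.
  rewrite [2 * eps * _]mulrC; apply: frob_le; first by rewrite mulr_ge0 ?sqrtr_ge0.
  apply: (@le_trans _ _ (\sum_(i < (T - k.+1).+1) (norm1 d * (2 * eps)) ^+ 2)).
    rewrite frob2_col; apply: ler_sum => i _.
    rewrite -sqr_frob ler_sqr ?nnegrE ?frob_ge0 //.
    have -> : col i (Delta *m Z) =
        \sum_(l < k.+1) coef d (l + 0) *: (Delta *m z (i + l)%N).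
      have -> : col i (Delta *m Z) = Delta *m col i Z.
        by rewrite colE -mulmxA -colE.
      have -> : col i Z = \sum_(l < k.+1) coef d l *: z (i + l)%N.
        by apply/colP => a; rewrite !mxE.
      by rewrite mulmx_sumr; apply: eq_bigr => l _; rewrite -scalemxAr addn0.
    apply: (@frob_filter_le _ _ _ _ _ 0 (2 * eps)
      (fun l => Delta *m z (i + l)%N)) => [|l lk].
      by rewrite mulr_ge0 // ltW.
    rewrite Deltaz ?window // (le_trans (frobB _ _)) //.
    by rewrite mulr2n mulrDl mul1r lerD ?we.
  rewrite sumr_const card_ord [leRHS]exprMn sqr_sqrtr ?ler0n //.
  rewrite [leRHS]mulrC -[leLHS]mulr_natl.
  by rewrite ler_wpM2r ?sqr_ge0 // ler_nat; lia.
have Zlow (q : 'rV[R]_(n + m)) :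
    eps / rho * Num.sqrt T%:R * norm1 d * frob q <= frob (q *m Z).
  pose xi := lsubmx q; pose eta := rsubmx q.
  have qE : q = row_mx xi eta by rewrite hsubmxK.
  pose noise := row_mx xi 0 *m M_mx k S1.1 1%:M *m (D_mx n d *m hankel k.+1 w1).
  have qZ : q *m Z = q *m (M_mx k S1.1 S1.2 *m D_mx m d *m hankel k.+1 u) + noise.
    apply/rowP => i; rewrite /noise {2}qE !mulmxA !mul_M_mx !mul_D_mx addmxE.
    pose Y p (C : 'M[R]_(n, p)) eta' j :=
      \sum_(s < k.+1) coef d (s + j) *: markov S1.1 C xi eta' s.
    rewrite (@mul_hankelE _ _ _ _ u (Y _ S1.2 eta)).
    rewrite (@mul_hankelE _ _ _ _ w1 (Y _ 1%:M 0)) -/us.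
    transitivity ((xi *m (\sum_(l < k.+1) coef d l *: xs (i + l)%N) +
                   eta *m (\sum_(l < k.+1) coef d l *: us (i + l)%N)) 0 0).
      rewrite -mul_row_col -qE !mxE; apply: eq_bigr => a _; rewrite mxE.
      congr (_ * (_ : 'cV[R]__) a 0); rewrite -[LHS]vsubmxK !linear_sum.
      by congr col_mx; apply: eq_bigr => l _;
        rewrite linearZ /= (col_mxKu, col_mxKd).
    rewrite (@filtered_state _ _ S1.1 d (fun j => xs (i + j)%N)
      (fun j => S1.2 *m us (i + j)%N + seq_of_input w1 (i + j)%N)) //; last first.
      by move=> j jk; rewrite addnS rec1 // window // ltnW.
    rewrite mulmx_sumr -big_split /= summxE -big_split /=; apply: eq_bigr => j _.
    rewrite mulmxDr -scalemxAr scalemxAl addrAC mulmxA -mulmxDl addmxE.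
    congr (_ + _); congr (fun_of_matrix (_ *m _) 0 0).
    rewrite /Y big_ord_recl mulmxDl [RHS]big_ord_recl /= scaler0 mul0mx add0r.
    rewrite add0n addrC; congr (_ + _); rewrite mulmx_suml.
    by apply: eq_bigr => s _; rewrite -scalemxAl -!mulmxA mul1mx.
  have nE : frob noise <= spectral_norm (M_mx k S1.1 1%:M) * frob q *
      (eps * Num.sqrt (T * k.+1)%:R * norm1 d).
    apply: le_trans (frobM _ _) _; rewrite ler_pM ?frob_ge0 ?frob_noise ?(ltW eps0) //.
    apply: le_trans (spectral_norm_ub_row _ _) _.
    rewrite ler_wpM2l ?spectral_norm_ge0 // ler_frob qE !frob2_row_mx frob2_0 addr0.
    by rewrite lerDl frob2_ge0.
  have := excit q; rewrite mulrDl => h.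
  have := frobB (q *m Z) noise; rewrite {1}qZ addrK => h'.
  by move: nE h h'; lra.
apply: spectral_norm_le_row => [|p]; first by rewrite mulr_ge0 ?ltW.
have := Zlow (p *m Delta); rewrite -mulmxA => /le_trans/(_ (frobM _ _)) h.
have {}h := le_trans h (ler_wpM2l (frob_ge0 p) DeltaZ).
have T0 : 0 < Num.sqrt T%:R :> R by rewrite sqrtr_gt0 ltr0n (leq_trans _ kT).
have P0 : 0 < eps / rho * Num.sqrt T%:R * norm1 d by rewrite !mulr_gt0 ?invr_gt0.
rewrite -(ler_pM2l P0); apply: le_trans h _.
rewrite le_eqVlt; apply/orP; left; apply/eqP.
by field; rewrite gt_eqF.
Qed.
End Data.

(** * Universal inputs *)

Section Universality.
Context {R : realType}.

(** The inequality that the input has to satisfy, for one system and one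
    annihilating filter [d] of its state matrix. *)
Definition exciting n m k T (eps rho : R) (u : input R m T)
    (S : system R n.+1 m) (d : 'cV[R]_k.+1) : Prop :=
  eps * Num.sqrt (T * k.+1)%:R * norm1 d * spectral_norm (M_mx k S.1 1%:M)
    + eps / rho * Num.sqrt T%:R * norm1 d
  <= singular_value (n.+1 + m) (M_mx k S.1 S.2 *m D_mx m d *m hankel k.+1 u).

Lemma gamma_pk_le n m (Spk : set (system R n.+1 m)) (S : system R n.+1 m) :
  Spk S -> gamma_pk Spk <= singular_value n.+1 (controllability_mx S.1 S.2).
Proof.
move=> SS; apply: ge_inf; last by exists S.
exists 0 => _ [S' _ <-]; apply: singular_value_ge => v.
by rewrite mul0r frob_ge0.
Qed.

Lemma spectral_norm_M_mx n k (A : 'M[R]_n) (r : R) : 1 <= r ->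
  spectral_norm A <= r -> spectral_norm (M_mx k A 1%:M) <= k.+1%:R * r ^+ k.
Proof.
move=> r1 Ar; have r0 : 0 <= r by exact: le_trans r1.
have c0 : 0 <= r ^+ k by exact: exprn_ge0.
apply: spectral_norm_le_row => [|v]; first by rewrite mulr_ge0.
have I1 : spectral_norm (1%:M : 'M[R]_n) <= r.
  apply: le_trans r1; apply: spectral_norm_le => // x.
  by rewrite mul1mx mul1r.
rewrite -(hsubmxK v) mul_M_mx; set v' := row_mx _ _.
have rv0 : 0 <= r ^+ k * frob v' by rewrite mulr_ge0 ?frob_ge0.
rewrite -mulrA; apply: frob_le; first by rewrite mulr_ge0.
rewrite frob2_mxrow; apply: (@le_trans _ _ (\sum_(i < k.+1) (r ^+ k * frob v') ^+ 2)).
  apply: ler_sum => i _; rewrite -sqr_frob ler_sqr ?nnegrE ?frob_ge0 //.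
  by apply: markov_growth => //; exact: leq_ord.
rewrite sumr_const card_ord [leRHS]exprMn -[leLHS]mulr_natl ler_wpM2r ?sqr_ge0 //.
by rewrite -natrX ler_nat; nia.
Qed.

(** For the impulse input of amplitude [beta] the singular value grows linearly
    in [beta], while [T] is fixed and the other side of the inequality is a
    bounded multiple of [norm1 (d S.1)]. *)
Lemma exists_exciting_input n m k (eps rho : R) (Spk : set (system R n.+1 m))
    (d : 'M[R]_n.+1 -> 'cV[R]_k.+1) :
  0 < eps -> 0 < rho -> bounded_systems Spk -> 0 < gamma_pk Spk ->
  (forall S, Spk S -> \sum_(i < k.+1) d S.1 i 0 *: S.1 ^+ i = 0) ->
  exists T : nat, exists2 u : input R m T, (k < T)%N &
    forall S, Spk S -> exciting eps rho u S (d S.1).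
Proof.
move=> eps0 rho0 [r0 Sr0] gamma0 dA; pose r := Num.max 1 r0.
have r1 : 1 <= r by rewrite le_max lexx.
have Sr S : Spk S -> spectral_norm (row_mx S.1 S.2) <= r.
  by move=> /Sr0/le_trans -> //; rewrite le_max lexx orbT.
have [c c0 Hc] := @filtered_markov_lb _ n.+1 m k r _ r1 gamma0.
have [T kT Hu] := @impulse_input R m k.
pose C := eps * Num.sqrt (T * k.+1)%:R * (k.+1%:R * r ^+ k)
          + eps / rho * Num.sqrt T%:R.
have rk0 : 0 <= r ^+ k by rewrite exprn_ge0 // (le_trans ler01).
have C0 : 0 <= C.
  by rewrite addr_ge0 ?mulr_ge0 ?sqrtr_ge0 ?invr_ge0 ?(ltW eps0) ?(ltW rho0).
have [u uP] := Hu (C / c) (divr_ge0 C0 (ltW c0)).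
exists T, u => // S SS; have d0 := norm1_ge0 (d S.1).
have Ar : spectral_norm S.1 <= r := le_trans (spectral_norm_row_mxl _ _) (Sr S SS).
have Br : spectral_norm S.2 <= r := le_trans (spectral_norm_row_mxr _ _) (Sr S SS).
have ctrb (xi : 'rV[R]_n.+1) :
    gamma_pk Spk * frob xi <= frob (xi *m controllability_mx S.1 S.2).
  apply: le_trans (singular_value_lb _ _).
  by rewrite ler_wpM2r ?frob_ge0 // gamma_pk_le.
apply: (@le_trans _ _ (C * norm1 (d S.1))).
  rewrite mulrDl lerD // -!mulrA; do 2!rewrite ler_wpM2l ?sqrtr_ge0 ?(ltW eps0) //.
  by rewrite mulrA mulrC ler_wpM2r // spectral_norm_M_mx.
apply: (@singular_value_ge _ (n + m)) => v.
rewrite mulmxA; apply: le_trans (uP _).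
have := Hc _ _ _ Ar Br ctrb (dA _ SS) v.
move=> /(ler_wpM2l (divr_ge0 C0 (ltW c0))); apply: le_trans.
rewrite le_eqVlt; apply/orP; left; apply/eqP.
by field; rewrite gt_eqF.
Qed.

(** Restricted to row vectors [row_mx xi 0], the product [M *m D *m H] factors
    through the controllability matrix, by matrices that are bounded uniformly
    in the system up to the factor [norm1 d]. *)
Lemma exciting_controllable n m k T (eps rho : R) (u : input R m T)
    (S : system R n.+1 m) (d : 'cV[R]_k.+1) (xi : 'rV[R]_n.+1) :
  (k <= n.+1)%N -> 0 < eps -> 0 < rho -> 0 < norm1 d ->
  exciting eps rho u S d ->
  eps / rho * Num.sqrt T%:R / (k.+1%:R * (frob (hankel k.+1 u) + 1)) * frob xi <=
  frob (xi *m controllability_mx S.1 S.2).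
Proof.
move=> kn eps0 rho0 d0 exc; set h := frob (hankel k.+1 u).
have h0 : 0 <= h := frob_ge0 _.
set y := frob (xi *m _); have y0 : 0 <= y := frob_ge0 _.
have g_le : frob (\mxrow_(j < k.+1) markov S.1 S.2 xi 0 j) <= y.
  rewrite ler_frob frob2_mxrow mul_controllability_mx [leLHS]big_ord_recl frob2_0 add0r.
  rewrite (big_ord_widen n.+1 (fun i => frob2 (markov S.1 S.2 xi 0 i.+1))) //.
  by rewrite big_mkcond; apply: ler_sum => i _; case: ifP => // _; exact: frob2_ge0.
have gj_le j : (j <= k)%N -> frob (markov S.1 S.2 xi 0 j) <= y.
  move=> jk; apply: le_trans g_le; rewrite ler_frob frob2_mxrow.
  rewrite (bigD1 (inord j)) //= inordK // lerDl.
  by apply: sumr_ge0 => ? _; exact: frob2_ge0.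
have MD_le : frob (row_mx xi 0 *m (M_mx k S.1 S.2 *m D_mx m d)) <=
    k.+1%:R * (norm1 d * y).
  have dy0 : 0 <= norm1 d * y by rewrite mulr_ge0 ?(ltW d0).
  rewrite mulmxA mul_M_mx mul_D_mx; apply: frob_le; first by rewrite mulr_ge0.
  rewrite frob2_mxrow.
  apply: (@le_trans _ _ (\sum_(i < k.+1) (norm1 d * y) ^+ 2)).
    apply: ler_sum => i _; rewrite -sqr_frob ler_sqr ?nnegrE ?frob_ge0 //.
    exact: frob_filter_le.
  rewrite sumr_const card_ord [leRHS]exprMn -[leLHS]mulr_natl ler_wpM2r ?sqr_ge0 //.
  by rewrite -natrX ler_nat; nia.
have := @singular_value_lb _ (n + m) _
  (M_mx k S.1 S.2 *m D_mx m d *m hankel k.+1 u) (row_mx xi 0).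
have vxi : frob (row_mx xi (0 : 'rV[R]_m)) = frob xi.
  by rewrite /frob frob2_row_mx frob2_0 addr0.
rewrite mulmxA [X in _ * X]vxi => H1.
have H2 : eps / rho * Num.sqrt T%:R * norm1 d * frob xi <=
    k.+1%:R * (norm1 d * y) * (h + 1).
  apply: le_trans (_ : k.+1%:R * (norm1 d * y) * h <= _); last first.
    by rewrite ler_wpM2l ?mulr_ge0 ?(ltW d0) // lerDl.
  apply: le_trans (ler_wpM2r h0 MD_le); apply: le_trans (frobM _ _).
  apply: le_trans H1; rewrite ler_wpM2r ?frob_ge0 //; apply: le_trans exc.
  by rewrite lerDr !mulr_ge0 ?sqrtr_ge0 ?spectral_norm_ge0 ?(ltW eps0) ?(ltW d0).
have K0 : 0 < k.+1%:R * (h + 1) by rewrite mulr_gt0 // ltr_wpDl.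
rewrite mulrAC ler_pdivrMr // -(ler_pM2r d0).
by move: H2; rewrite -!mulrA; congr (_ <= _); ring.
Qed.

Lemma char_poly_annihilates n (A : 'M[R]_n.+1) :
  \sum_(i < n.+2) (char_poly A)`_i *: A ^+ i = 0.
Proof.
apply: etrans (Cayley_Hamilton A).
rewrite -[in RHS](@coefK _ (char_poly A)) size_char_poly.
rewrite poly_def rmorph_sum; apply: eq_bigr => i _.
by rewrite /= horner_mxZ rmorphXn /= horner_mx_X.
Qed.

(** The Chebyshev radius is at most the diameter, since centers are taken in
    the set itself; so the condition at accuracy [rho / 2] is enough. *)
Lemma exciting_universal n m k T (eps rho : R) (u : input R m T)
    (Spk : set (system R n.+1 m)) (d : 'M[R]_n.+1 -> 'cV[R]_k.+1) :
  (k < T)%N -> 0 < eps -> 0 < rho -> bounded_systems Spk ->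
  (forall S, Spk S -> d S.1 != 0) ->
  (forall S, Spk S -> \sum_(i < k.+1) d S.1 i 0 *: S.1 ^+ i = 0) ->
  (forall S, Spk S -> exciting eps (rho / 2) u S (d S.1)) ->
  universal_input eps Spk rho u.
Proof.
move=> kT eps0 rho0 [r Sr] d0 dA exc [u' x] [S0 S0pk [S0x /= u'E]].
rewrite u'E in S0x *; rewrite /informative; set X := _ `&` _.
have close C S : X C -> X S ->
    spectral_norm (row_mx C.1 C.2 - row_mx S.1 S.2) <= rho.
  move=> [Cx Cpk] [Sx _].
  rewrite -[leRHS](_ : 2 * (rho / 2) = rho); last by field.
  apply: (consistent_close kT eps0 _ (d0 _ Cpk) (dA _ Cpk) _ Cx Sx) => [|v].
    by rewrite divr_gt0.
  apply: le_trans (@singular_value_lb _ (n + m) _ _ v).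
  by rewrite ler_wpM2r ?frob_ge0 // exc.
split; first by exists r => S [_ /Sr].
have X0 : X S0 by split.
set rad := fun C : system R n.+1 m =>
  sup [set spectral_norm (row_mx C.1 C.2 - row_mx S.1 S.2) | S in X].
have ub C : X C -> has_ubound
    [set spectral_norm (row_mx C.1 C.2 - row_mx S.1 S.2) | S in X].
  by move=> XC; exists rho => _ [S XS <-]; exact: close.
apply: (@le_trans _ _ (rad S0)).
  apply: ge_inf; last by exists S0.
  exists 0 => _ [C XC <-].
  apply: (@le_trans _ _ (spectral_norm (row_mx C.1 C.2 - row_mx C.1 C.2))).
    exact: spectral_norm_ge0.
  by apply: (ub_le_sup (ub _ XC)); exists C.
apply: ge_sup.
  by exists (spectral_norm (row_mx S0.1 S0.2 - row_mx S0.1 S0.2)), S0.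
by move=> _ [S XS <-]; exact: close.
Qed.

End Universality.

Theorem theorem22 (R : realType) (n m : nat) (eps : R)
    (Spk : set (system R n.+1 m)) (rho : R) (k : nat)
    (eps_gt0 : 0 < eps)
    (Spk_nonempty : Spk !=set0)
    (Spk_bounded : bounded_systems Spk)
    (rho_gt0 : 0 < rho)
    (k_range : (1 <= k <= n.+1)%N)
    (Spk_k : Spk `<=` minpoly_degree_le k) :
  (forall d : 'M[R]_n.+1 -> 'cV[R]_k.+1, annihilating_coefs d ->
     (exists (T : nat) (u : input R m T),
        (k.+1 <= T)%N /\
        forall (A : 'M[R]_n.+1) (B : 'M[R]_(n.+1, m)), Spk (A, B) ->
          eps * Num.sqrt (T * k.+1)%:R * norm1 (d A) *
            spectral_norm (M_mx k A 1%:M)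
          + eps / rho * Num.sqrt T%:R * norm1 (d A)
          <= singular_value (n.+1 + m)
               (M_mx k A B *m D_mx m (d A) *m hankel k.+1 u))
     <-> 0 < gamma_pk Spk)
  /\ (0 < gamma_pk Spk -> enables_universal_design eps Spk rho).
Proof.
split=> [d dP|gamma0].
  split=> [[T [u [kT exc]]]|gamma0].
    pose c := eps / rho * Num.sqrt T%:R / (k.+1%:R * (frob (hankel k.+1 u) + 1)).
    have c0 : 0 < c.
      rewrite divr_gt0 ?mulr_gt0 ?invr_gt0 ?sqrtr_gt0 ?ltr0n //.
        exact: leq_trans kT.
      by rewrite ltr_wpDl ?frob_ge0.
    apply: lt_le_trans c0 _; apply: lb_le_inf.
      have [S SS] := Spk_nonempty.
      by exists (singular_value n.+1 (controllability_mx S.1 S.2)), S.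
    move=> _ [[A B] SS <-]; apply: singular_value_ge => xi.
    have [_ dk _] := dP A (Spk_k _ SS).
    apply: (exciting_controllable (d := d A)) => //.
    - by case/andP: k_range.
    - rewrite (lt_le_trans ltr01) // -[leLHS]normr1 -dk /norm1 (bigD1 ord_max) //=.
      by rewrite lerDl sumr_ge0.
    - exact: exc.
  have [|T [u kT exc]] :=
      exists_exciting_input (d := d) eps_gt0 rho_gt0 Spk_bounded gamma0.
    by move=> S /Spk_k/dP[].
  by exists T, u; split=> // A B; exact: (exc (A, B)).
pose d (A : 'M[R]_n.+1) : 'cV[R]_n.+2 := \col_i (char_poly A)`_i.
have dA (S : system R n.+1 m) : Spk S -> \sum_(i < n.+2) d S.1 i 0 *: S.1 ^+ i = 0.
  move=> _; apply: etrans (char_poly_annihilates S.1).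
  by apply: eq_bigr => i _; rewrite mxE.
have rho2 : 0 < rho / 2 by rewrite divr_gt0.
(* The filter is free here, so the characteristic polynomial will do. *)
have [T [u kT exc]] := exists_exciting_input eps_gt0 rho2 Spk_bounded gamma0 dA.
exists T; split; first exact: leq_trans kT.
exists u; apply: (exciting_universal (d := d) kT) => // S _.
apply/eqP => /colP/(_ ord_max); rewrite !mxE => /eqP.
have := monicP (char_poly_monic S.1); rewrite lead_coefE size_char_poly /= => ->.
by rewrite oner_eq0.
Qed.
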